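(* Let $d = 3$, let $p > 1 + \frac{4}{d-2}$ be real, and let $m \geq 2 \max\left(\frac{(d+1)(d+6)}{2}, \frac{(d+1)(d+4)}{2}+5\right)+2$ be an integer. Let $\Gamma_d := \{ (t,x) \in \mathbb{R}^{1+d}: t>0,\ |x| \leq t \}$. Then there exist a defocusing potential $F\colon \mathbb{R}^m \to \mathbb{R}$ which is homogeneous of order $p+1$, and a smooth (nowhere vanishing) function $u \colon \Gamma_d \to \mathbb{R}^m \setminus \{0\}$ which satisfies $$\Box u = (\nabla_{\mathbb{R}^m} F)(u)$$ on $\Gamma_d$ and is discretely self-similar in the sense that there exists $S>0$ such that $$ u(e^S t, e^S x ) = e^{-\frac{2}{p-1}S}\, u(t,x)$$ for all $(t,x) \in \Gamma_d$.
   Context: Points of $\mathbb{R}^{1+d}$ are written $(t,x)$ with $t\in\mathbb{R}$, $x\in\mathbb{R}^d$; $|x|$ is the Euclidean norm; $\Box := -\partial_t^2 + \sum_{i=1}^d \partial_{x_i}^2$ acts componentwise. A potential is a function $F\colon\mathbb{R}^m\to\mathbb{R}$ that is smooth away from the origin (it need not be smooth at the origin). It is defocusing if $F(v)>0$ for all $v\ne0$, and homogeneous of order $\alpha$ if $F(\lambda v)=\lambda^\alpha F(v)$ for all $\lambda>0$ and $v\in\mathbb{R}^m$. Smoothness of $u$ on $\Gamma_d$ means smoothness all the way up to the boundary $|x|=t$, $t>0$, of the cone, not only in the interior. *)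

(* Defs.v *)
From mathcomp Require Import all_boot all_order all_algebra.
From mathcomp Require Import all_classical all_reals all_analysis.

Set Implicit Arguments.
Unset Strict Implicit.
Unset Printing Implicit Defensive.

Import Order.TTheory GRing.Theory Num.Theory.
Import numFieldNormedType.Exports.

Local Open Scope classical_set_scope.
Local Open Scope ring_scope.

Definition evec (R : realType) (n : nat) (i : 'I_n) : 'rV[R]_n := delta_mx 0 i.

(* [|x|] is the sup norm on ['rV[R]_n], hence this separate definition. *)
Definition enorm (R : realType) (n : nat) (x : 'rV[R]_n) : R :=
  Num.sqrt (\sum_(i < n) x 0 i ^+ 2).

Definition pderiv (R : realType) (n : nat) (W : normedModType R) (i : 'I_n)
    (f : 'rV[R]_n -> W) : 'rV[R]_n -> W := 'D_(evec R i) f.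

(* All partial derivatives of order at most [k] exist and are continuous on [U];
   meant for open [U]. *)
Fixpoint Ck (R : realType) (n : nat) (W : normedModType R) (k : nat)
    (U : set 'rV[R]_n) (f : 'rV[R]_n -> W) : Prop :=
  (forall x, U x -> {for x, continuous f}) /\
  (if k is k'.+1 then
     forall i : 'I_n, (forall x, U x -> derivable f x (evec R i)) /\
                      Ck k' U (pderiv i f)
   else True).

Definition smooth_open (R : realType) (n : nat) (W : normedModType R)
    (U : set 'rV[R]_n) (f : 'rV[R]_n -> W) : Prop :=
  forall k : nat, Ck k U f.

(* Smoothness on an arbitrary set, as extendability to an open neighbourhood:
   the total function [f] represents its restriction to [A] together with such
   an extension.  When [A] is contained in the closure of its interior, the
   derivatives of [f] at points of [A], boundary included, do not depend on the
   extension. *)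
Definition smooth_upto (R : realType) (n : nat) (W : normedModType R)
    (A : set 'rV[R]_n) (f : 'rV[R]_n -> W) : Prop :=
  exists U : set 'rV[R]_n, [/\ open U, A `<=` U & smooth_open U f].

Definition grad (R : realType) (n : nat) (F : 'rV[R]_n -> R) (v : 'rV[R]_n) :
    'rV[R]_n :=
  \row_(i < n) pderiv i F v.

Definition potential (R : realType) (m : nat) (F : 'rV[R]_m -> R) : Prop :=
  smooth_open [set v | v != 0] F.

Definition defocusing (R : realType) (m : nat) (F : 'rV[R]_m -> R) : Prop :=
  forall v, v != 0 -> 0 < F v.

Definition homogeneous (R : realType) (m : nat) (alpha : R)
    (F : 'rV[R]_m -> R) : Prop :=
  forall (lambda : R) (v : 'rV[R]_m),
    0 < lambda -> F (lambda *: v) = lambda `^ alpha * F v.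

(* A point [(t, x)] of spacetime is a row vector of length [1 + d] with [t] as
   coordinate 0. *)
Definition time (R : realType) (d : nat) (z : 'rV[R]_(1 + d)) : R :=
  z 0 (lshift d ord0).

Definition space (R : realType) (d : nat) (z : 'rV[R]_(1 + d)) : 'rV[R]_d :=
  rsubmx z.

Definition Gamma (R : realType) (d : nat) : set 'rV[R]_(1 + d) :=
  [set z | 0 < time z /\ enorm (space z) <= time z].

Definition dalembertian (R : realType) (d m : nat)
    (u : 'rV[R]_(1 + d) -> 'rV[R]_m) (z : 'rV[R]_(1 + d)) : 'rV[R]_m :=
  - pderiv (lshift d ord0) (pderiv (lshift d ord0) u) z
  + \sum_(i < d) pderiv (rshift 1 i) (pderiv (rshift 1 i) u) z.

(* Main.v *)
(* Put a = 2 / (p - 1), which lies in (0, 1/2) because p > 5, and q = |x|^2 / t^2.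
   We look for u = t^-a exp(J ln t) U(q) with a curve U on the unit sphere and a
   skew-symmetric J rotating two of the coordinates with angular velocity 1/e; such
   a field is discretely self-similar with S = 2 pi e.  If F is homogeneous of order
   p + 1 and invariant under the rotations, then Box u = (grad F)(u) constrains U only
   through |U'|^2, <J U, U'> and |J U|^2: it amounts to a linear system of identities
   between these functions of q and the value of F along the curve.

   Polynomial solutions of this system come from the free radial wave whose energy in
   the ball of radius r is ((t + r)^(1 - 2a) - (t - r)^(1 - 2a)) / (4 (1 - 2a)).  It is
   singular on the cone, but its Taylor polynomials of large degree are not, and the
   error made by truncating is controlled by the Taylor coefficients of (1 - y)^(-2a),
   which tend to 0 since 2a < 1.  For a long enough truncation the Gram matrix is
   positive definite and F(u) > 0 up to the cone.

   A curve with these Gram data is written down in polar coordinates: the rotating pair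
   has radius e |J U| and its angle is dictated by <J U, U'>; one coordinate is e q, and
   another planar pair completes the sphere and spirals fast enough to produce the
   missing speed, which is positive for small e.  Finally the coordinate e q makes q a
   smooth function of v / |v|, so that F(v) = |v|^(p + 1) exp(G(v / |v|)), where G has
   coefficients depending on q, can be given any compatible value and gradient along the
   curve, and is positive and smooth off the origin. *)

Require Import Defs.
From mathcomp Require Import all_boot all_order all_algebra.
From mathcomp Require Import all_classical all_reals all_analysis.
From mathcomp Require Import ring lra.

Import Order.TTheory GRing.Theory Num.Theory.
Import numFieldNormedType.Exports.

Local Open Scope classical_set_scope.
Local Open Scope ring_scope.

Set Implicit Arguments.
Unset Strict Implicit.
Unset Printing Implicit Defensive.

(** * Derivative rules for pointwise expressions *)

Lemma is_deriveD_fun (R : realType) (V : normedModType R) (f g : V -> R)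
    (x v : V) (df dg : R) :
  is_derive x v f df -> is_derive x v g dg ->
  is_derive x v (fun y => f y + g y) (df + dg).
Proof. exact: is_deriveD. Qed.

Lemma is_deriveM_fun (R : realType) (V : normedModType R) (f g : V -> R)
    (x v : V) (df dg : R) :
  is_derive x v f df -> is_derive x v g dg ->
  is_derive x v (fun y => f y * g y) (df * g x + f x * dg).
Proof.
move=> hf hg; have := @is_deriveM _ _ f g x v df dg hf hg.
by rewrite addrC [g x *: df]mulrC.
Qed.

Lemma is_deriveN_fun (R : realType) (V : normedModType R) (f : V -> R)
    (x v : V) (df : R) :
  is_derive x v f df -> is_derive x v (fun y => - f y) (- df).
Proof. exact: is_deriveN. Qed.

(** Restriction to the line through [x] with direction [v]; this is how the one-variable chain rule
    reaches [is_derive_comp_fun]. *)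
Lemma is_derive1_dir (R : realType) (V : normedModType R) (f : V -> R)
    (x v : V) (df : R) :
  is_derive x v f df <-> is_derive (0 : R) (1 : R) (fun h : R => f (h *: v + x)) df.
Proof.
have E : 'D_v f x = 'D_1 (fun h : R => f (h *: v + x)) 0.
  rewrite /derive; set g1 := fun h => h^-1 *: _; set g2 := fun h => h^-1 *: _.
  suff -> : g1 = g2 by [].
  by apply/funext => h; rewrite /g1 /g2 /= addr0 scale0r add0r [_%:A]mulr1.
split=> -[d e]; split.
- exact: (derivable1P _ _ _).1 d.
- by rewrite -E.
- exact: (derivable1P _ _ _).2 d.
- by rewrite E.
Qed.

Lemma is_derive_comp_fun (R : realType) (V : normedModType R) (h : R -> R)
    (f : V -> R) (x v : V) (dh df : R) :
  is_derive (f x) 1 h dh -> is_derive x v f df ->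
  is_derive x v (fun y => h (f y)) (dh * df).
Proof.
move=> hh hf; apply/is_derive1_dir.
have hf' := (is_derive1_dir _ _ _ _).1 hf.
apply: (@is_derive1_comp _ h (fun t : R => f (t *: v + x)) 0) => //.
by rewrite scale0r add0r.
Qed.

Lemma is_derive_inv_id {R : realType} (t : R) : t != 0 ->
  is_derive t 1 (fun x : R => x^-1) (- t^-1 ^+ 2).
Proof.
move=> t0; have := @is_deriveV R id t 1 1 t0 (is_derive_id _ _).
by rewrite scaler1 exprVn.
Qed.

(** * Smooth functions *)

(* Partial derivatives are only required to exist as functions [g], so that
   closure properties need no congruence argument. *)
Fixpoint Cdir (R : realType) (V : normedModType R) (I : Type) (e : I -> V)
    (k : nat) (U : set V) (f : V -> R) : Prop :=
  (forall x, U x -> {for x, continuous f}) /\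
  (if k is k'.+1 then
     forall i, exists2 g : V -> R, (forall x, U x -> is_derive x (e i) f (g x)) &
       Cdir e k' U g
   else True).


Section Cdir_theory.
Context {R : realType} {V : normedModType R} {I : Type} (e : I -> V).
Implicit Types (U : set V) (f g : V -> R) (k : nat).

Lemma Cdir_cont k U f x : Cdir e k U f -> U x -> {for x, continuous f}.
Proof. by case: k => [|k] [cf _] Ux; exact: cf. Qed.

Lemma CdirW k U f : Cdir e k.+1 U f -> Cdir e k U f.
Proof.
elim: k f => [|k ih] f [cf df]; split=> // i.
by have [g hg /ih cg] := df i; exists g.
Qed.

Lemma Cdir_sub k U U' f : U' `<=` U -> Cdir e k U f -> Cdir e k U' f.
Proof.
move=> sU; elim: k f => [|k ih] f [cf df]; first by split=> // x /sU; exact: cf.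
split; first by move=> x /sU; exact: cf.
by move=> i; have [g hg /ih cg] := df i; exists g => // x /sU; exact: hg.
Qed.

Lemma Cdir_eq k U f g : open U -> (forall x, U x -> f x = g x) ->
  Cdir e k U f -> Cdir e k U g.
Proof.
move=> oU fg cf.
have nfg x : U x -> \near x, f x = g x.
  by move=> Ux; move: (open_nbhs_nbhs (conj oU Ux)); apply: filterS => y /fg.
have cg x : U x -> {for x, continuous g}.
  move=> Ux; have := Cdir_cont cf Ux.
  rewrite /prop_for /continuous_at -(fg _ Ux) => cfx.
  apply: cvg_trans cfx; apply: near_eq_cvg.
  by apply: filterS (nfg _ Ux) => y ->.
case: k cf => [|k] [_ df]; split=> // i; have [h dfh ch] := df i; exists h => // x Ux.
exact: near_eq_is_derive (nfg _ Ux) (dfh _ Ux).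
Qed.

Lemma Cdir_cst k U (c : R) : Cdir e k U (fun=> c).
Proof.
elim: k c => [|k ih] c; first by split=> // x _; exact: cvg_cst.
split=> [x _|i]; first exact: cvg_cst.
by exists (fun=> 0) => // x _; exact: is_derive_cst.
Qed.

Lemma CdirD k U f g : Cdir e k U f -> Cdir e k U g ->
  Cdir e k U (fun x => f x + g x).
Proof.
elim: k f g => [|k ih] f g [cf df] [cg dg].
  by split=> // x Ux; apply: cvgD; [exact: cf|exact: cg].
split=> [x Ux|i].
- by apply: cvgD; [exact: cf|exact: cg].
- have [f' hf' cf'] := df i; have [g' hg' cg'] := dg i.
  exists (fun x => f' x + g' x); last exact: ih.
  by move=> x Ux; apply: is_deriveD_fun; [exact: hf'|exact: hg'].
Qed.

Lemma CdirM k U f g : Cdir e k U f -> Cdir e k U g ->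
  Cdir e k U (fun x => f x * g x).
Proof.
elim: k f g => [|k ih] f g Cf Cg; have [cf df] := Cf; have [cg dg] := Cg.
  by split=> // x Ux; apply: cvgM; [exact: cf|exact: cg].
split=> [x Ux|i].
  by apply: cvgM; [exact: cf|exact: cg].
have [f' hf' cf'] := df i; have [g' hg' cg'] := dg i.
exists (fun x => f' x * g x + f x * g' x).
  by move=> x Ux; apply: is_deriveM_fun; [exact: hf'|exact: hg'].
by apply: CdirD; apply: ih => //; exact: CdirW.
Qed.

Lemma CdirN k U f : Cdir e k U f -> Cdir e k U (fun x => - f x).
Proof.
move=> cf; have := CdirM (Cdir_cst k U (-1)) cf.
by congr (Cdir _ _ _ _); apply/funext => x; rewrite mulN1r.
Qed.

Lemma CdirB k U f g : Cdir e k U f -> Cdir e k U g ->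
  Cdir e k U (fun x => f x - g x).
Proof. by move=> cf cg; apply: CdirD => //; exact: CdirN. Qed.

Lemma CdirX k U f n : Cdir e k U f -> Cdir e k U (fun x => f x ^+ n).
Proof.
move=> cf; elim: n => [|n ih]; first exact: Cdir_cst.
have := CdirM cf ih.
by congr (Cdir _ _ _ _); apply/funext => x; rewrite exprS.
Qed.

Lemma Cdir_sum k U n (F : 'I_n -> V -> R) :
  (forall i, Cdir e k U (F i)) -> Cdir e k U (fun x => \sum_(i < n) F i x).
Proof.
elim: n F => [|n ih] F cF.
  by under eq_fun do rewrite big_ord0; exact: Cdir_cst.
by under eq_fun do rewrite big_ord_recr /=; apply: CdirD => //; exact: ih.
Qed.

End Cdir_theory.

Definition Cline {R : realType} (k : nat) (O : set R) (h : R -> R) : Prop :=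
  Cdir (fun _ : unit => 1 : R) k O h.

Lemma Cdir_comp {R : realType} {V : normedModType R} {I : Type} (e : I -> V)
    k (O : set R) (U : set V) (h : R -> R) (f : V -> R) :
  Cline k O h -> Cdir e k U f -> (forall x, U x -> O (f x)) ->
  Cdir e k U (fun x => h (f x)).
Proof.
move=> + + UO; elim: k h f UO => [|k ih] h f UO Ch Cf.
  split=> // x Ux; apply: continuous_comp.
    exact: Cdir_cont Cf Ux.
  exact: Cdir_cont Ch (UO _ Ux).
split=> [x Ux|i].
  apply: continuous_comp; first exact: Cdir_cont Cf Ux.
  exact: Cdir_cont Ch (UO _ Ux).
have [h' dh ch'] := Ch.2 tt; have [f' df cf'] := Cf.2 i.
exists (fun x => h' (f x) * f' x).
  by move=> x Ux; apply: is_derive_comp_fun; [exact: dh (UO _ Ux)|exact: df].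
by apply: CdirM => //; apply: ih => //; exact: CdirW.
Qed.

Lemma is_derive1_cont {R : realType} (h : R -> R) (x l : R) :
  is_derive x 1 h l -> {for x, continuous h}.
Proof.
by move=> [d _]; apply/differentiable_continuous; exact/derivable1_diffP.
Qed.

Lemma ClineS {R : realType} k (O : set R) (h h' : R -> R) :
  (forall x, O x -> is_derive x 1 h (h' x)) -> Cline k O h' -> Cline k.+1 O h.
Proof.
move=> dh ch'; split=> [x Ox|[]]; first exact: is_derive1_cont (dh _ Ox).
by exists h'.
Qed.

(** Bootstrapping: as long as the derivative is an expression in [h] itself, each order of
    smoothness of [h] gives the next. This suits the exponential, the inverse and the square
    root. *)
Lemma Cline_self {R : realType} (O : set R) (h h' : R -> R) :
  (forall x, O x -> is_derive x 1 h (h' x)) ->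
  (forall k, Cline k O h -> Cline k O h') -> forall k, Cline k O h.
Proof.
move=> dh ch'; elim=> [|k /ch' ih]; last exact: ClineS ih.
by split=> // x Ox; exact: is_derive1_cont (dh _ Ox).
Qed.

Lemma Cline_id {R : realType} k (O : set R) : Cline k O id.
Proof.
by apply: (@Cline_self _ _ _ (fun=> 1)) => j _; exact: Cdir_cst.
Qed.

Lemma Cline_expR {R : realType} k (O : set R) : Cline k O (@expR R).
Proof. exact: (@Cline_self _ _ _ expR). Qed.

Lemma Cline_inv {R : realType} k (O : set R) :
  (forall x, O x -> x != 0) -> Cline k O (fun x => x^-1).
Proof.
move=> O0; apply: (@Cline_self _ _ _ (fun x => - (x^-1 ^+ 2))) => [x Ox|j cj].
  exact: is_derive_inv_id (O0 _ Ox).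
by apply: CdirN; apply: CdirX.
Qed.

Lemma Cline_ln {R : realType} k : Cline k [set x : R | 0 < x] (@ln R).
Proof.
apply: (@Cline_self _ _ _ (fun x => x^-1)) => j _.
by apply: Cline_inv => x /= x0; rewrite gt_eqF.
Qed.

Lemma Cline_sqrt {R : realType} k : Cline k [set x : R | 0 < x] Num.sqrt.
Proof.
apply: (@Cline_self _ _ _ (fun x => (2 * Num.sqrt x)^-1)) => j cj.
apply: (@Cdir_comp _ _ _ _ _ [set y : R | y != 0] _ (fun y => y^-1)).
- exact: Cline_inv.
- by apply: CdirM => //; exact: Cdir_cst.
- by move=> x /= x0; rewrite mulf_neq0// gt_eqF// sqrtr_gt0.
Qed.

Lemma Cline_sincos {R : realType} k (O : set R) : Cline k O (@sin R) /\ Cline k O (@cos R).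
Proof.
elim: k => [|k [cs cc]].
  by split; split=> // x _; [exact: continuous_sin|exact: continuous_cos].
split.
  exact: (@ClineS _ _ _ _ cos).
by apply: (@ClineS _ _ _ _ (fun x => - sin x)); exact: CdirN.
Qed.

Lemma Cline_horner {R : realType} k (O : set R) (p : {poly R}) :
  Cline k O (horner p).
Proof.
elim: k p => [|k ih] p.
  by split=> // x _; exact: continuous_horner.
by apply: (@ClineS _ _ _ _ (horner p^`())) => // x _; exact: is_derive_poly.
Qed.

Lemma Cline_derive {R : realType} k (O : set R) (h : R -> R) :
  open O -> Cline k.+1 O h -> Cline k O ('D_1 h).
Proof.
move=> oO [_ /(_ tt)[g dg cg]]; apply: Cdir_eq cg => // x Ox.
by have [_ ->] := dg x Ox.
Qed.

Definition smooth {R : realType} (h : R -> R) : Prop := forall k, Cline k setT h.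

Lemma smooth_is_derive {R : realType} (h : R -> R) (x : R) :
  smooth h -> is_derive x 1 h ('D_1 h x).
Proof.
move=> /(_ 1%N)[_ /(_ tt)[g dg _]]; apply: derivableP.
by have [] := dg x Logic.I.
Qed.

Lemma smooth_derive {R : realType} (h : R -> R) : smooth h -> smooth ('D_1 h).
Proof. by move=> sh k; apply: Cline_derive (sh _); exact: openT. Qed.

(** * Transfer to the classes [Ck], for scalar and row-valued functions *)

Lemma Cdir_Ck {R : realType} n k (U : set 'rV[R]_n) (f : 'rV[R]_n -> R) :
  open U -> Cdir (@evec R n) k U f -> Ck k U f.
Proof.
move=> oU; elim: k f => [|k ih] f [cf df]; split=> // i; have [g dg cg] := df i; split.
  by move=> x Ux; have [] := dg x Ux.
apply: ih; apply: Cdir_eq cg => // x Ux.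
by have [_ <-] := dg x Ux.
Qed.

Lemma derivable_row {R : realType} n m (f : 'rV[R]_n -> 'rV[R]_m) x v :
  (forall j, derivable (fun y => f y 0 j) x v) -> derivable f x v.
Proof. by move=> df; apply/derivable_mxP => i j; rewrite (ord1 i). Qed.

Lemma derive_row {R : realType} n m (f : 'rV[R]_n -> 'rV[R]_m) x v j :
  (forall j, derivable (fun y => f y 0 j) x v) ->
  'D_v f x 0 j = 'D_v (fun y => f y 0 j) x.
Proof. by move=> /derivable_row df; rewrite derive_mx// mxE. Qed.

Lemma cvg_row {R : realType} (T : Type) (F : set_system T) {FF : Filter F} m
    (f : T -> 'rV[R]_m) (l : 'rV[R]_m) :
  (forall j, f y 0 j @[y --> F] --> l 0 j) -> f @ F --> l.
Proof.
move=> cf; apply/cvgrPdist_le => /= e e0.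
near=> y.
rewrite /Num.Def.normr/= mx_normrE (bigmax_le _ (ltW e0))//= => i _.
rewrite !mxE/= (ord1 i.1); move: {i}(i.2).
near: y; apply: filter_forall => j.
exact: (cvgrPdist_le _ _).1 (cf j) _ e0.
Unshelve. all: by end_near. Qed.

Lemma continuous_row {R : realType} n m (f : 'rV[R]_n -> 'rV[R]_m) x :
  (forall j, {for x, continuous (fun y => f y 0 j)}) -> {for x, continuous f}.
Proof. by move=> cf; apply: (@cvg_row _ _ (nbhs x) (nbhs_filter x)) => j; exact: cf. Qed.

Lemma Cdir_Ck_row {R : realType} n m k (U : set 'rV[R]_n)
    (f : 'rV[R]_n -> 'rV[R]_m) :
  open U -> (forall j, Cdir (@evec R n) k U (fun y => f y 0 j)) -> Ck k U f.
Proof.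
move=> oU; elim: k f => [|k ih] f Cf.
  by split=> // x Ux; apply: continuous_row => j; exact: Cdir_cont (Cf j) Ux.
split=> [x Ux|i]; first by apply: continuous_row => j; exact: Cdir_cont (Cf j) Ux.
have df x j : U x -> derivable (fun y => f y 0 j) x (evec R i).
  by move=> Ux; have [g dg _] := (Cf j).2 i; have [] := dg x Ux.
split=> [x Ux|]; first by apply: derivable_row => j; exact: df.
apply: ih => j; have [g dg cg] := (Cf j).2 i.
apply: Cdir_eq cg => // x Ux; rewrite /pderiv derive_row => [|j']; last exact: df.
by have [_ ->] := dg x Ux.
Qed.

(** * Polynomial Gram data *)

(* Taylor coefficients of [(1 - y) ^ (- 2 a)]. *)
Fixpoint bcoef (R : realType) (a : R) (n : nat) : R :=
  if n is j.+1 then bcoef a j * (2 * a + j%:R) / j.+1%:R else 1.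

Lemma bcoefE {R : realType} (a : R) n :
  bcoef a n.+1 = bcoef a n * (2 * a + n%:R) / n.+1%:R.
Proof. by []. Qed.

Arguments bcoef : simpl never.

Lemma bcoefS {R : realType} (a : R) n :
  (n%:R + 1) * bcoef a n.+1 = bcoef a n * (2 * a + n%:R).
Proof.
have : n.+1%:R != 0 :> R by rewrite pnatr_eq0.
by rewrite bcoefE -[n.+1%:R]natr1 => n0; rewrite mulrC divfK.
Qed.

Lemma bcoef_gt0 {R : realType} (a : R) n : 0 < a -> 0 < bcoef a n.
Proof.
move=> a0; elim: n => [|n ih]; first exact: ltr01.
rewrite bcoefE divr_gt0 ?ltr0n// mulr_gt0// ltr_wpDr// mulr_gt0//.
Qed.

Lemma bcoef_le {R : realType} (a : R) n : 0 < a -> a < 1 / 2 ->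
  bcoef a n.+1 <= bcoef a n.
Proof.
move=> a0 a1; have := bcoefS a n; have := bcoef_gt0 n.+1 a0; have := bcoef_gt0 n a0.
have : 0 <= n%:R :> R by [].
set x := bcoef a n; set y := bcoef a n.+1; set k := n%:R => k0 x0 y0 e.
nra.
Qed.

(** Multiplied by the positive factor (2 a + n)(n + 2), the second difference becomes [bcoef a n.+1]
    times (1 - 2 a)(2 - 2 a), which is nonnegative for a < 1/2. *)
Lemma bcoef_convex {R : realType} (a : R) n : 0 < a -> a < 1 / 2 ->
  2 * bcoef a n.+1 <= bcoef a n + bcoef a n.+2.
Proof.
move=> a0 a1; have := bcoefS a n; have := bcoefS a n.+1.
have := bcoef_gt0 n.+2 a0; have := bcoef_gt0 n.+1 a0; have := bcoef_gt0 n a0.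
rewrite -[n.+1%:R]natr1; have : 0 <= n%:R :> R by [].
set x := bcoef a n; set y := bcoef a n.+1; set w := bcoef a n.+2.
set k := n%:R => k0 x0 y0 w0 e1 e2.
have k1 : 0 < k + 1 by lra.
have k2 : 0 < k + 2 by lra.
have ex : (2 * a + k) * x = (k + 1) * y by lra.
suff : 0 <= (2 * a + k) * (k + 2) * (x + w - 2 * y).
  by rewrite pmulr_rge0 ?subr_ge0// mulr_gt0//; lra.
have -> : (2 * a + k) * (k + 2) * (x + w - 2 * y) =
  y * ((k + 1) * (k + 2) + (2 * a + k) * (2 * a + k + 1) - 2 * (2 * a + k) * (k + 2)).
  have -> : (2 * a + k) * (k + 2) * (x + w - 2 * y) =
    (k + 2) * ((2 * a + k) * x) + (2 * a + k) * ((k + 1 + 1) * w)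
    - 2 * (2 * a + k) * (k + 2) * y by ring.
  by rewrite ex e1; ring.
apply: mulr_ge0; first exact: ltW.
have -> : (k + 1) * (k + 2) + (2 * a + k) * (2 * a + k + 1) -
  2 * (2 * a + k) * (k + 2) = (1 - 2 * a) * (2 - 2 * a) by ring.
by apply: mulr_ge0; lra.
Qed.

(* With [k = 1 - 2 a], [bcoef a n] is the product of the factors
   [1 - k / (j + 1) <= 1 / (1 + k / (j + 1))]. *)
Lemma bcoef_harmonic {R : realType} (a : R) n : 0 < a -> a < 1 / 2 ->
  bcoef a n * (1 + (1 - 2 * a) * series (@harmonic R) n) <= 1.
Proof.
move=> a0 a1; elim: n => [|n ih].
  by rewrite /series /= big_geq// mulr0 addr0 mul1r.
rewrite seriesSr /harmonic bcoefE /=.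
set s := series _ n in ih *; set x := bcoef a n in ih *.
have s0 : 0 <= s by apply: sumr_ge0 => i _; rewrite invr_ge0.
have x0 : 0 < x by exact: bcoef_gt0.
rewrite -[n.+1%:R]natr1; have : 0 <= n%:R :> R by [].
set k := n%:R => k0; have k1 : 0 < k + 1 by lra.
apply: le_trans ih.
rewrite -[x * _ / _]mulrA -[x * _ * _]mulrA ler_pM2l// -mulrA.
have k1' : k + 1 != 0 by rewrite gt_eqF.
rewrite -subr_ge0.
set y := (Y in 0 <= Y).
have -> : y = (1 - 2 * a) * (1 - 2 * a) * ((k + 1)^-1 * (s + (k + 1)^-1)).
  by rewrite /y; field.
have k2 : 0 <= (k + 1)^-1 by rewrite invr_ge0; exact: ltW.
apply: mulr_ge0; apply: mulr_ge0; [lra | lra | exact: k2 | exact: addr_ge0].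
Qed.

(** The harmonic series diverges, so [bcoef_harmonic] forces some coefficient below [e];
    monotonicity then carries the bound to the later index 2 n + 3. *)
Lemma bcoef_small {R : realType} (a e : R) : 0 < a -> a < 1 / 2 -> 0 < e ->
  exists j, bcoef a (j.*2 + 3) < e.
Proof.
move=> a0 a1 e0.
have H : exists n, e^-1 < 1 + (1 - 2 * a) * series (@harmonic R) n.
  apply: contrapT => /forallNP Hn; apply: (@dvg_harmonic R).
  apply: nondecreasing_is_cvgn.
    by apply: nondecreasing_series => i _ _; rewrite invr_ge0.
  exists (e^-1 / (1 - 2 * a)) => _ [n _ <-].
  rewrite ler_pdivlMr; last lra.
  have /negP := Hn n; rewrite -leNgt mulrC; lra.
have [n Hn] := H; exists n.
have le1 m : bcoef a (n + m) <= bcoef a n.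
  elim: m => [|m ih]; first by rewrite addn0.
  by rewrite addnS; apply: le_trans ih; exact: bcoef_le.
rewrite -addnn -!addnA; apply: le_lt_trans (le1 _) _.
have := bcoef_harmonic n a0 a1.
set s := 1 + _ in Hn *.
have s0 : 0 < s by apply: lt_trans Hn; rewrite invr_gt0.
rewrite -ler_pdivlMr// div1r => /le_lt_trans; apply.
by rewrite invf_plt ?posrE.
Qed.

(** With [odds] below, y^3 [odds](y^2) + y^4 [evens](y^2) collects the terms of degrees 3 to 2 n + 3
    in the Taylor series of (1 - y)^(-2 a). *)
Definition evens (R : realType) (a : R) (n : nat) : {poly R} :=
  \sum_(j < n) bcoef a (j.*2 + 4) *: 'X^j.

Definition odds (R : realType) (a : R) (n : nat) : {poly R} :=
  \sum_(j < n.+1) bcoef a (j.*2 + 3) *: 'X^j.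

Lemma natr_double {R : realType} n : n.*2%:R = 2 * n%:R :> R.
Proof. by rewrite -mul2n natrM. Qed.

Lemma horner_derivZXn {R : realType} (c z : R) n :
  z * (c *: 'X^n)^`().[z] = n%:R * c * z ^+ n.
Proof.
rewrite derivZ derivXn hornerZ hornerMn hornerXn.
case: n => [|n] /=; first by rewrite mulr0n mulr0 mulr0 !mul0r.
by rewrite -mulr_natl exprS; ring.
Qed.

Lemma hornerZXn {R : realType} (c z : R) n : (c *: 'X^n).[z] = c * z ^+ n.
Proof. by rewrite hornerZ hornerXn. Qed.

(** Coefficientwise this is the recurrence [bcoefS] from an odd index to the next even one. The top
    coefficient of [odds] has no partner in [evens], whence the error term. *)
Lemma evens_odds_ode1 {R : realType} (a z : R) n :
  2 * z * (evens a n)^`().[z] + 4 * (evens a n).[z] =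
  2 * z * (odds a n)^`().[z] + (2 * a + 3) * (odds a n).[z]
  - (2 * a + (n.*2 + 3)%:R) * bcoef a (n.*2 + 3) * z ^+ n.
Proof.
elim: n => [|n ih].
  rewrite /evens /odds big_ord0 big_ord1 deriv0 horner0 double0 add0n.
  by rewrite -[2 * z * (_ *: _)^`().[z]]mulrA horner_derivZXn hornerZXn /= !expr0; ring.
rewrite /evens /odds big_ord_recr [in RHS]big_ord_recr /= -/(evens a n) -/(odds a n).
rewrite !derivD !hornerD !hornerZXn.
have e1 := horner_derivZXn (bcoef a (n.*2 + 4)) z n.
have e2 := horner_derivZXn (bcoef a (n.+1.*2 + 3)) z n.+1.
have e3 := bcoefS a (n.*2 + 3).
have : 2 * z * (evens a n)^`().[z] + 2 * (n%:R * bcoef a (n.*2 + 4) * z ^+ n)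
  + 4 * ((evens a n).[z] + bcoef a (n.*2 + 4) * z ^+ n) =
  2 * z * (odds a n)^`().[z] + 2 * (n.+1%:R * bcoef a (n.+1.*2 + 3) * z ^+ n.+1)
  + (2 * a + 3) * ((odds a n).[z] + bcoef a (n.+1.*2 + 3) * z ^+ n.+1) -
  (2 * a + (n.+1.*2 + 3)%:R) * bcoef a (n.+1.*2 + 3) * z ^+ n.+1.
  have -> : 2 * z * (evens a n)^`().[z] = 2 * z * (odds a n)^`().[z] + (2 * a + 3) * (odds a n).[z]
  - (2 * a + (n.*2 + 3)%:R) * bcoef a (n.*2 + 3) * z ^+ n - 4 * (evens a n).[z] by rewrite -ih; ring.
  move: e3; rewrite -addnS !natrD !natr_double -[n.+1%:R]natr1.
  set x := bcoef a (n.*2 + 4); set y := bcoef a (n.*2 + 3) => e3.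
  have -> : (2 * a + (2 * n%:R + 3)) * y = (2 * n%:R + 3 + 1) * x by rewrite e3; ring.
  idtac; by ring.
rewrite -e1 -e2 => e; etransitivity; first etransitivity; [| exact: e | ]; ring.
Qed.

(** The recurrence from an even index to the next odd one; the constant is (2 a + 2) times the
    coefficient of index 2. Here the truncation leaves no error. The two identities are the parity
    parts of (1 - y) f' = 2 a f. *)
Lemma evens_odds_ode2 {R : realType} (a z : R) n :
  2 * z * (odds a n)^`().[z] + 3 * (odds a n).[z] =
  2 * (2 * a + 1) * (a * (a + 1)) +
  z * (2 * z * (evens a n)^`().[z] + (4 + 2 * a) * (evens a n).[z]).
Proof.
elim: n => [|n ih].
  rewrite /evens /odds big_ord0 big_ord1 deriv0 horner0 double0 add0n.
  rewrite -[2 * z * (_ *: _)^`().[z]]mulrA horner_derivZXn hornerZXn /= !expr0 /bcoef.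
  by field.
rewrite /evens /odds big_ord_recr [in RHS]big_ord_recr /= -/(evens a n) -/(odds a n).
rewrite !derivD !hornerD !hornerZXn.
have e1 := horner_derivZXn (bcoef a (n.*2 + 4)) z n.
have e2 := horner_derivZXn (bcoef a (n.+1.*2 + 3)) z n.+1.
have e3 := bcoefS a (n.*2 + 4).
have : 2 * z * (odds a n)^`().[z] + 2 * (n.+1%:R * bcoef a (n.+1.*2 + 3) * z ^+ n.+1)
  + 3 * ((odds a n).[z] + bcoef a (n.+1.*2 + 3) * z ^+ n.+1) =
  2 * (2 * a + 1) * (a * (a + 1)) + z *
  (2 * z * (evens a n)^`().[z] + 2 * (n%:R * bcoef a (n.*2 + 4) * z ^+ n) +
   (4 + 2 * a) * ((evens a n).[z] + bcoef a (n.*2 + 4) * z ^+ n)).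
  have -> : 2 * z * (odds a n)^`().[z] = 2 * (2 * a + 1) * (a * (a + 1)) +
    z * (2 * z * (evens a n)^`().[z] + (4 + 2 * a) * (evens a n).[z]) - 3 * (odds a n).[z]
    by rewrite -ih; ring.
  have -> : (n.+1.*2 + 3 = (n.*2 + 4).+1)%N by rewrite doubleS !addSn -!addnS.
  move: e3; rewrite natrD natr_double -[n.+1%:R]natr1 exprS.
  set x := bcoef a (n.*2 + 4); set y := bcoef a (n.*2 + 4).+1 => e3.
  transitivity (2 * (2 * a + 1) * (a * (a + 1)) +
    z * (2 * z * (evens a n)^`().[z] + (4 + 2 * a) * (evens a n).[z])
    + (2 * n%:R + 4 + 1) * y * (z * z ^+ n)); first by ring.
  by rewrite e3; ring.
rewrite -e1 -e2 => e; etransitivity; first etransitivity; [| exact: e | ]; ring.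
Qed.

Lemma evens0 {R : realType} (a : R) : evens a 0 = 0.
Proof. by rewrite /evens big_ord0. Qed.

Lemma odds0 {R : realType} (a : R) : odds a 0 = (bcoef a 3)%:P.
Proof. by rewrite /odds big_ord1 /= expr0 double0 add0n -mul_polyC mulr1. Qed.

Lemma evensS {R : realType} (a z : R) n :
  (evens a n.+1).[z] = (evens a n).[z] + bcoef a (n.*2 + 4) * z ^+ n.
Proof. by rewrite /evens big_ord_recr hornerD hornerZXn. Qed.

Lemma oddsS {R : realType} (a z : R) n :
  (odds a n.+1).[z] = (odds a n).[z] + bcoef a (n.*2 + 5) * z ^+ n.+1.
Proof.
by rewrite /odds big_ord_recr hornerD hornerZXn /= doubleS !addSn -!addnS.
Qed.

(** With c = [bcoef a], the inner coefficients on the left are 2 c_(2j+3) - c_(2j+2) - c_(2j+4),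
    nonpositive by convexity. Only the two ends, where a neighbour is missing, survive on the
    right. *)
Lemma evens_odds_le1 {R : realType} (a z : R) n : 0 < a -> a < 1 / 2 -> 0 <= z <= 1 ->
  2 * ((odds a n.+1).[z] - (evens a n.+1).[z]) + (1 - z) * (evens a n.+1).[z] <=
  2 * bcoef a 3 - bcoef a 4 + (2 * bcoef a (n.*2 + 5) - bcoef a (n.*2 + 4)) * z ^+ n.+1.
Proof.
move=> a0 a1 /andP[z0 z1]; elim: n => [|n ih].
  rewrite oddsS evensS odds0 evens0 horner0 hornerC double0 !add0n expr1 expr0.
  by rewrite -subr_ge0; set y := (Y in 0 <= Y); have -> : y = 0 by rewrite /y; ring.
rewrite oddsS evensS doubleS !addSn -!addnS.
have cx : 2 * bcoef a (n.*2 + 5) <= bcoef a (n.*2 + 4) + bcoef a (n.*2 + 6).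
  by have := bcoef_convex (n.*2 + 4) a0 a1; rewrite -!addnS.
have zn : 0 <= z ^+ n.+1 by exact: exprn_ge0.
move: (ih); rewrite (exprS z n.+1).
move: (z ^+ n.+1) zn (bcoef a (n.*2 + 5)) (bcoef a (n.*2 + 4)) (bcoef a (n.*2 + 6))
  (bcoef a (n.*2 + 7)) cx ((odds a n.+1).[z]) ((evens a n.+1).[z]) {ih} => t t0 x5 x4 x6 x7 cx o e ih.
have : 0 <= t * (x4 + x6 - 2 * x5) by rewrite mulr_ge0// subr_ge0.
nra.
Qed.

(** The quotient of the coefficients of indices 2 j + 4 and 2 j + 3 is (2 j + 3 + 2 a) / (2 j + 4).
    It increases with j because 2 a < 1, so it is at least its value (2 a + 3) / 4 at j = 0. *)
Lemma evens_odds_le2 {R : realType} (a z : R) n : 0 < a -> a < 1 / 2 -> 0 <= z <= 1 ->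
  (2 * a + 3) * ((odds a n).[z] - (evens a n).[z]) <=
  (1 - 2 * a) * (evens a n).[z] + (2 * a + 3) * (bcoef a (n.*2 + 3) * z ^+ n).
Proof.
move=> a0 a1 /andP[z0 z1]; elim: n => [|n ih].
  by rewrite odds0 evens0 horner0 hornerC double0 !add0n expr0; nra.
rewrite oddsS evensS doubleS !addSn -!addnS.
have := bcoefS a (n.*2 + 3); rewrite -addnS natrD.
have := bcoef_gt0 (n.*2 + 4) a0.
have zn : 0 <= z ^+ n by exact: exprn_ge0.
have kn : 0 <= n.*2%:R :> R by [].
move: (n.*2%:R) kn => k k0.
move: (z ^+ n.+1) (z ^+ n) zn (bcoef a (n.*2 + 5)) (bcoef a (n.*2 + 4))
  (bcoef a (n.*2 + 3)) ((odds a n).[z]) ((evens a n).[z]) ih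
  => t' t t0 x5 x4 x3 o e ih x40 e3.
have e3' : (2 * a + 3) * x3 <= 4 * x4.
  have : (2 * a + k + 3) * ((2 * a + 3) * x3) <= (2 * a + k + 3) * (4 * x4).
    have -> : (2 * a + k + 3) * ((2 * a + 3) * x3) = (2 * a + 3) * (x3 * (2 * a + (k + 3))) by ring.
    rewrite -e3; have : 0 <= k * x4 * (1 - 2 * a).
      by apply: mulr_ge0; [apply: mulr_ge0 => //; exact: ltW|lra].
    lra.
  by rewrite ler_pM2l//; lra.
have : 0 <= t * (4 * x4 - (2 * a + 3) * x3) by rewrite mulr_ge0// subr_ge0.
lra.
Qed.

Lemma evens_ge {R : realType} (a z : R) n : 0 < a -> 0 <= z ->
  bcoef a 4 <= (evens a n.+1).[z].
Proof.
move=> a0 z0; elim: n => [|n ih].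
  by rewrite evensS evens0 horner0 double0 !add0n expr0 mulr1 add0r.
rewrite evensS; apply: le_trans ih _; rewrite lerDl mulr_ge0 ?exprn_ge0//.
exact/ltW/bcoef_gt0.
Qed.

(** The coefficients decrease, so each paired difference is nonnegative, and the last coefficient of
    [odds] is unpaired. *)
Lemma odds_evens_ge0 {R : realType} (a z : R) n : 0 < a -> a < 1 / 2 -> 0 <= z <= 1 ->
  bcoef a (n.*2 + 3) * z ^+ n <= (odds a n).[z] - (evens a n).[z].
Proof.
move=> a0 a1 /andP[z0 z1]; elim: n => [|n ih].
  by rewrite odds0 evens0 horner0 hornerC double0 !add0n expr0; lra.
rewrite oddsS evensS doubleS !addSn -!addnS.
have := bcoef_le (n.*2 + 3) a0 a1; rewrite -addnS.
have zn : 0 <= z ^+ n by exact: exprn_ge0.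
move: (z ^+ n.+1) (z ^+ n) zn (bcoef a (n.*2 + 5)) (bcoef a (n.*2 + 4))
  (bcoef a (n.*2 + 3)) ((odds a n).[z]) ((evens a n).[z]) ih
  => t' t t0 x5 x4 x3 o e ih h.
have : 0 <= t * (x3 - x4) by rewrite mulr_ge0// subr_ge0.
lra.
Qed.

(** This is positivity of the Gram determinant before the corrections of [gram_polys]. With S = O -
    E and h = a (a + 1), the difference of the two sides is E (2 h - (2 S + (1 - z) E)) - S^2. The
    first summand is bounded by [evens_odds_le1], and S^2 by the product of a bound on S
    proportional to E and a constant one, both up to small errors. *)
Lemma evens_odds_lt {R : realType} (a : R) : 0 < a -> a < 1 / 2 ->
  exists2 n, bcoef a (n.+1.*2 + 3) < a ^+ 2 &
  forall z, 0 <= z <= 1 ->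
    (odds a n.+1).[z] ^+ 2 <
    (evens a n.+1).[z] * (2 * (a * (a + 1)) + z * (evens a n.+1).[z]).
Proof.
move=> a0 a1.
set h := a * (a + 1); have h0 : 0 < h by apply: mulr_gt0 => //; lra.
have x3E : bcoef a 3 = 2 / 3 * (1 + 2 * a) * h by rewrite /bcoef /h; field.
have x4E : bcoef a 4 = bcoef a 3 * (2 * a + 3) / 4 by [].
have x40 : 0 < bcoef a 4 by exact: bcoef_gt0.
have x43 : bcoef a 4 <= bcoef a 3 by exact: bcoef_le.
set x3 := bcoef a 3 in x3E x4E x43 *; set x4 := bcoef a 4 in x4E x40 x43 *.
set eta := (1 - 2 * a) / (2 * a + 3).
have a3 : 0 < 2 * a + 3 by lra.
have eta0 : 0 <= eta by rewrite divr_ge0//; lra.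
have eta1 : eta <= 1 / 3 by rewrite ler_pdivrMr//; lra.
set q := x3 - x4 / 2; have q0 : 0 < q by rewrite /q; lra.
(* The margin per unit of E that would remain if the truncation errors were zero. *)
set mu := 2 * h - 2 * x3 + x4 - eta * q.
have mu0 : 0 < mu.
  have qE : q = h * ((1 + 2 * a) * (5 - 2 * a) / 12) by rewrite /q x4E x3E; field.
  have -> : mu = h * (2 - (1 + 2 * a) * (5 - 2 * a) / 6 -
      eta * ((1 + 2 * a) * (5 - 2 * a) / 12)).
    by rewrite /mu qE x4E x3E; field.
  apply: mulr_gt0 => //.
  have w1 : (1 + 2 * a) * (5 - 2 * a) <= 8 by nra.
  have w0 : 0 <= (1 + 2 * a) * (5 - 2 * a) by nra.
  move: ((1 + 2 * a) * (5 - 2 * a)) w0 w1 => w w0 w1.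
  have : eta * w <= 1 / 3 * 8 by apply: ler_pM.
  lra.
(* Truncation errors of size [e] cost at most [e * c] of the margin [mu]. *)
set c := 3 / 2 + (q + 1 / 2) / x4.
have c0 : 0 < c.
  have : 0 < (q + 1 / 2) / x4 by apply: divr_gt0 => //; lra.
  by rewrite /c; lra.
have d0 : 0 < Num.min (a ^+ 2) (mu / c) by rewrite lt_min exprn_gt0//= divr_gt0.
have [n] := bcoef_small a0 a1 d0; rewrite lt_min => /andP[ea emu].
have e0 := bcoef_gt0 (n.*2 + 3) a0.
have le53 : bcoef a (n.+1.*2 + 3) <= bcoef a (n.*2 + 3).
  rewrite doubleS !addSn.
  by apply: (@le_trans _ _ (bcoef a (n.*2 + 3).+1)); exact: bcoef_le.
exists n; first exact: le_lt_trans ea.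
move=> z z01; have /andP[z0 z1] := z01.
have := evens_odds_le1 n a0 a1 z01; have := evens_odds_le2 n.+1 a0 a1 z01.
have := odds_evens_ge0 n.+1 a0 a1 z01; have := evens_ge n a0 z0.
have := bcoef_le (n.*2 + 4) a0 a1; rewrite -addnS.
have := bcoef_gt0 (n.+1.*2 + 3) a0.
have t0 : 0 <= z ^+ n.+1 by exact: exprn_ge0.
have t1 : z ^+ n.+1 <= 1 by exact: exprn_ile1.
move: le53; rewrite doubleS !addSn -!addnS.
have : bcoef a (n.*2 + 3) < 1 by apply: lt_trans ea _; rewrite expr2 mulr_ilt1 ?ltW//; lra.
move: (bcoef a (n.*2 + 3)) e0 emu {ea} => e e0 emu e1.
move: (bcoef a (n.*2 + 5)) (bcoef a (n.*2 + 4)) => x5 x5' x5e x50 x55.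
move: (z ^+ n.+1) t0 t1 ((odds a n.+1).[z]) ((evens a n.+1).[z]) => t t0 t1 O E x4E' SO.
set S := O - E in SO *; have -> : O = E + S by rewrite /S; ring.
move=> S2 S1.
have tx : x5 * t <= e by rewrite -[e]mulr1; apply: ler_pM => //; exact: ltW.
have tx0 : 0 <= x5 * t by apply: mulr_ge0 => //; exact: ltW.
have S0 : 0 <= S by exact: le_trans SO.
have E0 : 0 < E by exact: lt_le_trans x4E'.
have S1' : 2 * S + (1 - z) * E <= 2 * x3 - x4 + e.
  apply: le_trans S1 _; rewrite lerD2l; apply: le_trans tx.
  by apply: ler_wpM2r => //; lra.
have S2' : S <= eta * E + e.
  rewrite -(ler_pM2l a3); apply: le_trans S2 _.
  have -> : (2 * a + 3) * (eta * E + e) = (1 - 2 * a) * E + (2 * a + 3) * e.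
    by rewrite /eta; field; rewrite gt_eqF.
  by rewrite lerD2l ler_pM2l.
have zE : 0 <= (1 - z) * E by apply: mulr_ge0; [lra|exact: ltW].
have S3 : S <= q + e / 2 by rewrite /q; lra.
rewrite -subr_gt0.
have -> : E * (2 * h + z * E) - (E + S) ^+ 2 =
  E * (2 * h - (2 * S + (1 - z) * E)) - S * S by ring.
have P1 : E * (2 * h - (2 * x3 - x4 + e)) <= E * (2 * h - (2 * S + (1 - z) * E)).
  by rewrite ler_pM2l//; lra.
have P2 : S * S <= (eta * E + e) * (q + e / 2) by apply: ler_pM.
have eE : e <= e / x4 * E.
  by rewrite mulrAC ler_pdivlMr// ler_pM2l.
have qe : 0 < q + e / 2 by lra.
have P3 : (eta * E + e) * (q + e / 2) <= E * ((eta + e / x4) * (q + e / 2)).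
  have -> : E * ((eta + e / x4) * (q + e / 2)) = (eta * E + e / x4 * E) * (q + e / 2).
    by ring.
  by rewrite ler_pM2r// lerD2l.
have ec : e * c < mu by rewrite -ltr_pdivlMr.
have P4 : 0 < E * (2 * h - (2 * x3 - x4 + e) - (eta + e / x4) * (q + e / 2)).
  apply: mulr_gt0 => //.
  have -> : 2 * h - (2 * x3 - x4 + e) - (eta + e / x4) * (q + e / 2) =
    (mu - e * c) + e * (1 / 2 - eta / 2) + e / x4 * ((1 - e) / 2).
    by rewrite /mu /c; field; rewrite gt_eqF.
  have r1 : 0 < e * (1 / 2 - eta / 2) by apply: mulr_gt0 => //; lra.
  have r2 : 0 < e / x4 * ((1 - e) / 2) by apply: mulr_gt0; [exact: divr_gt0|lra].
  lra.
have -> : E * (2 * h - (2 * S + (1 - z) * E)) - S * S =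
  (E * (2 * h - (2 * S + (1 - z) * E)) - E * (2 * h - (2 * x3 - x4 + e)))
  + ((eta * E + e) * (q + e / 2) - S * S)
  + (E * ((eta + e / x4) * (q + e / 2)) - (eta * E + e) * (q + e / 2))
  + E * (2 * h - (2 * x3 - x4 + e) - (eta + e / x4) * (q + e / 2)) by ring.
by move: P4; rewrite -subr_ge0 in P1; rewrite -subr_ge0 in P2; rewrite -subr_ge0 in P3; lra.
Qed.

(* For a curve [U] on the unit sphere and a skew-symmetric matrix [J], the
   polynomials [La], [ka] and [I] stand for [|U'|^2], [<J U, U'>] and [|J U|^2].
   The three identities say that the field [u = t^-a exp(J ln t) U(|x|^2 / t^2)]
   satisfies [<Box u, exp(J ln t) J U> = 0], [<Box u, u> = (p + 1) F(u)] and
   [<Box u, d u> = d (F(u))] when [F(u) = t^(-2 a - 2) V]. *)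
Lemma gram_polys {R : realType} (a : R) : 0 < a -> a < 1 / 2 ->
  exists La ka I V : {poly R},
  [/\ forall z : R, 4 * z * (1 - z) * ka^`().[z] + (6 - 6 * z - 4 * a * z) * ka.[z]
        + 2 * z * I^`().[z] + (2 * a + 1) * I.[z] = 0,
      forall z : R, (2 / a + 2) * V.[z] =
        I.[z] - 4 * z * (1 - z) * La.[z] - 4 * z * ka.[z] - a * (a + 1),
      forall z : R, V^`().[z] = 2 * z * (1 - z) * La^`().[z]
        + (6 - 6 * z - 4 * a * z) * La.[z] + (2 * a + 1) * ka.[z] + 1 / 2 * I^`().[z] &
      forall z : R, 0 <= z <= 1 ->
        [/\ 0 < I.[z], 0 < V.[z] & ka.[z] ^+ 2 < I.[z] * La.[z]]].
Proof.
move=> a0 a1; have [n small lt] := evens_odds_lt a0 a1.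
have a0' : a != 0 by rewrite gt_eqF.
have x0 := bcoef_gt0 (n.+1.*2 + 3) a0.
have ode1 z := evens_odds_ode1 a z n.+1.
have ode2 z := evens_odds_ode2 a z n.+1.
move: ode1; rewrite natrD natr_double => ode1.
move: (bcoef a (n.+1.*2 + 3)) small x0 ode1 => x small x0 ode1.
have Ege z : 0 <= z -> 0 < (evens a n.+1).[z].
  by move=> z0; apply: lt_le_trans (evens_ge n a0 z0); exact: bcoef_gt0.
move: (evens a n.+1) (odds a n.+1) lt Ege ode1 ode2 => E O lt Ege ode1 ode2.
have m0 : 0 < n.+1%:R :> R by rewrite ltr0n.
set m : R := n.+1%:R in m0 ode1.
(* The Taylor polynomial fails the wave equation only in its top degree; the
   terms in [e] below are the resulting corrections. *)
set e := x * (a * (2 * m + 3 + 2 * a)) / (1 + a * (2 * m + 4)) / 4.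
have den0 : 0 < 1 + a * (2 * m + 4) by rewrite addr_gt0// mulr_gt0//; lra.
have den0' : 1 + a * (2 * m + 4) != 0 by rewrite gt_eqF.
have num0 : 0 < a * (2 * m + 3 + 2 * a) by apply: mulr_gt0 => //; lra.
have e0 : 0 < e by rewrite /e !divr_gt0// mulr_gt0.
have ex : e < a ^+ 2 / 4.
  rewrite /e ltr_pM2r; last lra.
  rewrite ltr_pdivrMr//; apply: ltr_pM => //; try exact: ltW.
  nra.
pose La := (1 / 4) *: E + ((2 + a^-1) * e / 2) *: 'X^(n.+1).
pose ka := 2%:P * 'X * La - (1 / 2) *: O.
(* [T] stands for |J U - 2 z U'|^2, the squared length of the part of the time derivative tangent to
   the sphere, and [ka - 2 z La] for its inner product with U'. Expanding the square gives [I]. *)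
pose T := (2 * (a * (a + 1)))%:P + 'X * E - (2 * e / a) *: 'X^(n.+2).
pose I := T + 4%:P * 'X^2 * La - 2%:P * 'X * O.
pose V := (a ^+ 2 / 2)%:P - (2 * e) *: 'X^(n.+2).
have LaE (z : R) : La.[z] = E.[z] / 4 + (2 + a^-1) * e / 2 * z ^+ n.+1.
  by rewrite /La hornerD !hornerZ hornerXn; field.
have kaE (z : R) : ka.[z] = 2 * z * La.[z] - O.[z] / 2.
  by rewrite /ka !(hornerXn, hornerD, hornerN, hornerM, hornerC, hornerX, hornerZ); field.
have TE (z : R) : T.[z] = 2 * (a * (a + 1)) + z * E.[z] - 2 * e / a * (z * z ^+ n.+1).
  by rewrite /T !(hornerXn, hornerD, hornerN, hornerM, hornerC, hornerX, hornerZ) [z ^+ n.+2]exprS; ring.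
have IE (z : R) : I.[z] = T.[z] + 4 * z ^+ 2 * La.[z] - 2 * z * O.[z].
  by rewrite /I hornerD hornerN [(T + _).[z]]hornerD !(hornerXn, hornerM, hornerC, hornerX); ring.
have VE (z : R) : V.[z] = a ^+ 2 / 2 - 2 * e * (z * z ^+ n.+1).
  by rewrite /V !(hornerXn, hornerD, hornerN, hornerM, hornerC, hornerX, hornerZ) [z ^+ n.+2]exprS; ring.
have dLaE (z : R) : z * La^`().[z] = z * E^`().[z] / 4 + (2 + a^-1) * e / 2 * (m * z ^+ n.+1).
  rewrite /La derivD hornerD mulrDr horner_derivZXn derivZ hornerZ -/m.
  by field.
have dkaE (z : R) : ka^`().[z] = 2 * La.[z] + 2 * (z * La^`().[z]) - O^`().[z] / 2.
  by rewrite /ka derivB !derivM !derivC derivX derivZ !(hornerXn, hornerD, hornerN, hornerM, hornerC, hornerX, hornerZ); field.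
have dXE (z : R) : ('X^(n.+2) : {poly R})^`().[z] = (m + 1) * z ^+ n.+1.
  by rewrite derivXn hornerMn hornerXn -mulr_natl natr1.
have dTE (z : R) : T^`().[z] = E.[z] + z * E^`().[z] - 2 * e / a * ((m + 1) * z ^+ n.+1).
  rewrite /T derivB derivD derivM derivC derivZ derivX.
  by rewrite !(hornerD, hornerN, hornerM, hornerC, hornerX, hornerZ) dXE; ring.
have dgen (P Q S : {poly R}) (z : R) :
    (P + 4%:P * 'X^2 * Q - 2%:P * 'X * S)^`().[z] =
    P^`().[z] + 8 * z * Q.[z] + 4 * z * (z * Q^`().[z]) - 2 * S.[z] - 2 * z * S^`().[z].
  rewrite derivB derivD !derivM !derivC !derivX.
  rewrite !(hornerMn, hornerXn, hornerD, hornerN, hornerM, hornerC, hornerX, hornerZ) /=.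
  by ring.
have dIE (z : R) : I^`().[z] = E.[z] + z * E^`().[z] - 2 * e / a * ((m + 1) * z ^+ n.+1)
   + 8 * z * La.[z] + 4 * z * (z * La^`().[z]) - 2 * O.[z] - 2 * z * O^`().[z].
  rewrite (dgen T La O) dTE; ring.
have dVE (z : R) : V^`().[z] = - (2 * e) * ((m + 1) * z ^+ n.+1).
  by rewrite /V derivD derivN derivC derivZ !(hornerXn, hornerD, hornerN, hornerM, hornerC, hornerX, hornerZ) dXE; ring.
clearbody m La ka T I V.
exists La, ka, I, V; split=> z.
(* The identity is z times [ode1] minus [ode2]; the value of [e] makes the remaining truncation
   terms cancel. The third identity below uses half of [ode1] in the same way. *)
- have r1 := ode1 z; have r2 := ode2 z.
  rewrite dkaE dIE IE TE dLaE kaE LaE.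
  transitivity (z * ((2 * z * E^`().[z] + 4 * E.[z]) -
     (2 * z * O^`().[z] + (2 * a + 3) * O.[z] - (2 * a + (2 * m + 3)) * x * z ^+ n.+1))
    - ((2 * z * O^`().[z] + 3 * O.[z]) - (2 * (2 * a + 1) * (a * (a + 1)) +
       z * (2 * z * E^`().[z] + (4 + 2 * a) * E.[z])))); last by rewrite r1 r2; ring.
  by rewrite /e; field; rewrite den0' a0'.
- by rewrite VE IE TE kaE LaE; field.
- have r1 := ode1 z.
  have -> : 2 * z * (1 - z) * La^`().[z] = 2 * (1 - z) * (z * La^`().[z]) by ring.
  rewrite dVE dIE dLaE kaE LaE.
  symmetry; transitivity (- (2 * e) * ((m + 1) * z ^+ n.+1) +
    1 / 2 * ((2 * z * E^`().[z] + 4 * E.[z]) -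
     (2 * z * O^`().[z] + (2 * a + 3) * O.[z] - (2 * a + (2 * m + 3)) * x * z ^+ n.+1)));
    last by rewrite r1; ring.
  by rewrite /e; field; rewrite den0' a0'.
- move=> z01; have /andP[z0 z1] := z01.
  have := lt z z01; have := Ege z z0.
  have t0 : 0 <= z ^+ n.+1 by exact: exprn_ge0.
  have t1 : z ^+ n.+1 <= 1 by exact: exprn_ile1.
  have zt0 : 0 <= z * z ^+ n.+1 by exact: mulr_ge0.
  have zt1 : z * z ^+ n.+1 <= 1 by rewrite mulr_ile1.
  have LE := LaE z; have KE := kaE z; have TE' := TE z; have IE' := IE z.
  have VE' := VE z.
  set t := z ^+ n.+1 in t0 t1 zt0 zt1 LE TE' VE'.
  move: (E.[z]) (O.[z]) LE KE TE' IE' => u v LE KE TE' IE' u0 uv.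
  have ai : 0 < a^-1 by rewrite invr_gt0.
  have k0 : 0 < (2 + a^-1) * e by apply: mulr_gt0 => //; lra.
  have L0 : 0 < La.[z].
    have : 0 <= (2 + a^-1) * e * t by apply: mulr_ge0 => //; exact: ltW.
    by rewrite LE; lra.
  have det : ka.[z] ^+ 2 < I.[z] * La.[z].
    rewrite -subr_gt0.
    (* Replacing J U by J U - 2 z U' does not change the Gram determinant, which is therefore T La -
       O^2 / 4: the quantity of [evens_odds_lt] over 4, plus a correction shown to be
       nonnegative. *)
    have -> : I.[z] * La.[z] - ka.[z] ^+ 2 = (u * (2 * (a * (a + 1)) + z * u) - v ^+ 2) / 4
       + e * t / 2 * ((2 + a^-1) * (2 * (a * (a + 1)) - 2 * e / a * (z * t)) + 2 * z * u).
      by rewrite IE' KE TE' LE; field.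
    rewrite ltr_pwDl//; first by rewrite divr_gt0// subr_gt0.
    apply: mulr_ge0; first by apply: divr_ge0 => //; apply: mulr_ge0 => //; exact: ltW.
    apply: addr_ge0; last by apply: mulr_ge0; [lra | exact: ltW].
    apply: mulr_ge0; first lra.
    have : 2 * e / a * (z * t) <= 2 * (a ^+ 2 / 4) / a * 1.
      apply: ler_pM => //.
        by apply: divr_ge0; [apply: mulr_ge0 => //|]; exact: ltW.
      by rewrite ler_pM2r// ler_pM2l// ltW.
    have -> : 2 * (a ^+ 2 / 4) / a * 1 = a / 2 by field.
    have aa : 0 < a * a by exact: mulr_gt0.
    lra.
  split=> //.
  + by rewrite -(pmulr_lgt0 _ L0); apply: le_lt_trans det; exact: sqr_ge0.
  + have : e * (z * t) <= e by rewrite -[leRHS]mulr1 ler_pM2l.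
    by rewrite VE'; lra.
Qed.

(** * A smooth retraction onto a neighbourhood of the unit interval *)

Lemma is_derive0_sqr_bound {R : realType} (f : R -> R) (C : R) :
  (forall x, `|f x| <= C * x ^+ 2) -> is_derive (0 : R) (1 : R) f 0.
Proof.
move=> fC.
have f0 : f 0 = 0.
  by apply/eqP; rewrite -normr_eq0 eq_le normr_ge0 andbT; have := fC 0; rewrite expr0n mulr0.
have C0 : 0 <= C by have := fC 1; rewrite expr1n mulr1; exact: le_trans.
have cv : (fun h : R => h^-1 *: ((f \o shift 0) (h *: (1 : R)) - f 0)) @ 0^' --> (0 : R).
  apply/cvgrPdist_le => e e0.
  exists (e / (C + 1)) => [|h /=]; first by rewrite /= divr_gt0// ltr_wpDl.
  rewrite !sub0r !normrN => he h0.
  rewrite f0 subr0 addr0 [h%:A]mulr1 normrM normfV.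
  rewrite ler_pdivrMl ?normr_gt0//; apply: le_trans (fC h) _.
  rewrite -normr_id -real_normK ?num_real// normr_id expr2 mulrA [leRHS]mulrC ler_wpM2r//.
  have : `|h| * (C + 1) <= e by rewrite -ler_pdivlMr ?ltW// ltr_wpDl.
  by have := normr_ge0 h; nra.
by apply: DeriveDef; [apply/cvg_ex; exists 0|apply/cvg_lim].
Qed.

(** The polynomial factor makes the family of such functions closed under differentiation: [P] is
    replaced by X^2 (P - P'). *)
Definition flat {R : realType} (P : {poly R}) (x : R) : R :=
  if 0 < x then P.[x^-1] * expR (- x^-1) else 0.

(** Since y^(i+2) <= (i+2)! e^y, each monomial gains two powers of 1/y. With y = 1/x this is the
    quadratic bound that gives [flat P] the derivative 0 at the origin. *)
Lemma horner_expRN_bound {R : realType} (P : {poly R}) :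
  exists C, forall y : R, 0 < y -> `|P.[y] * expR (- y)| <= C * y^-1 ^+ 2.
Proof.
have mono n (y : R) : 0 < y -> y ^+ n.+1 * expR (- y) <= n.+1`!%:R.
  move=> y0; rewrite expRN ler_pdivrMr ?expR_gt0//.
  rewrite -ler_pdivrMl ?ltr0n ?fact_gt0// mulrC.
  by apply: le_trans (expR_ge1Dxn n (ltW y0)); rewrite lerDr ler01.
exists (\sum_(i < size P) `|P`_i| * i.+2`!%:R) => y y0.
rewrite exprVn ler_pdivlMr ?exprn_gt0// horner_coef.
rewrite normrM (ger0_norm (expR_ge0 _)) -mulrA.
have w0 : 0 <= expR (- y) * y ^+ 2 by rewrite mulr_ge0 ?expR_ge0// exprn_ge0// ltW.
apply: le_trans (ler_wpM2r w0 (ler_norm_sum _ _ _)) _.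
rewrite mulr_suml; apply: ler_sum => i _.
rewrite normrM [`|y ^+ i|]ger0_norm ?exprn_ge0 ?(ltW y0)// -[leLHS]mulrA.
apply: ler_wpM2l => //.
apply: le_trans (mono i.+1 y y0).
by rewrite mulrCA -exprD addn2 mulrC.
Qed.

Lemma is_derive_flat {R : realType} (P : {poly R}) (x : R) :
  is_derive x 1 (flat P) (flat ('X^2 * (P - P^`())) x).
Proof.
have [x0|x0|->] := ltgtP x 0.
- rewrite /flat ltNge ltW//=.
  apply: (near_eq_is_derive _ (is_derive_cst 0 x 1)).
  by near=> y; rewrite ltNge ltW//; near: y; exact: lt_nbhsl.
- have dV : is_derive x 1 (fun y : R => y^-1) (- (x^-1 ^+ 2)).
    exact: is_derive_inv_id (lt0r_neq0 x0).
  have dP := is_derive_comp_fun (is_derive_poly P x^-1) dV.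
  have dE : is_derive x 1 (fun y : R => expR (- y^-1)) (expR (- x^-1) * x^-1 ^+ 2).
    have := @is_derive_comp_fun _ _ (@expR R) (fun y : R => - y^-1) x 1 _ _
      (is_derive_expR _) (is_deriveN_fun dV).
    by rewrite opprK.
  have := is_deriveM_fun dP dE.
  have -> : P^`().[x^-1] * - (x^-1 ^+ 2) * expR (- x^-1) +
      P.[x^-1] * (expR (- x^-1) * x^-1 ^+ 2) = flat ('X^2 * (P - P^`())) x.
    by rewrite /flat x0 !(hornerM, hornerX, hornerD, hornerN); ring.
  apply: near_eq_is_derive; near=> y; rewrite /flat ifT//.
  by near: y; exact: lt_nbhsr.
- rewrite {2}/flat ltxx; have [C PC] := horner_expRN_bound P.
  apply: (@is_derive0_sqr_bound _ _ (Num.max C 0)) => y; rewrite /flat.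
  case: ifPn => [y0|_]; last by rewrite normr0 mulr_ge0 ?sqr_ge0// le_max lexx orbT.
  have yV : 0 < y^-1 by rewrite invr_gt0.
  apply: le_trans (PC _ yV) _; rewrite invrK ler_wpM2r ?sqr_ge0//.
  by rewrite le_max lexx.
Unshelve. all: by end_near. Qed.

Lemma smooth_flat {R : realType} (P : {poly R}) : smooth (flat P).
Proof.
move=> k; elim: k P => [|k ih] P.
  by split=> // x _; exact: is_derive1_cont (is_derive_flat P x).
apply: (@ClineS _ _ _ _ (flat ('X^2 * (P - P^`())))); last exact: ih.
by move=> x _; exact: is_derive_flat.
Qed.

Lemma flat1_ge0 {R : realType} (x : R) : 0 <= flat 1 x.
Proof. by rewrite /flat; case: ifP => // _; rewrite hornerC mul1r expR_ge0. Qed.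

Lemma flat1_gt0 {R : realType} (x : R) : 0 < x -> 0 < flat 1 x.
Proof. by move=> x0; rewrite /flat x0 hornerC mul1r expR_gt0. Qed.

Lemma flat_le0 {R : realType} (P : {poly R}) (x : R) : x <= 0 -> flat P x = 0.
Proof. by rewrite /flat leNgt => /negbTE ->. Qed.

Lemma smoothD {R : realType} (f g : R -> R) :
  smooth f -> smooth g -> smooth (fun x => f x + g x).
Proof. by move=> sf sg k; exact: CdirD (sf k) (sg k). Qed.

Lemma smoothB {R : realType} (f g : R -> R) :
  smooth f -> smooth g -> smooth (fun x => f x - g x).
Proof. by move=> sf sg k; exact: CdirB (sf k) (sg k). Qed.

Lemma smoothM {R : realType} (f g : R -> R) :
  smooth f -> smooth g -> smooth (fun x => f x * g x).
Proof. by move=> sf sg k; exact: CdirM (sf k) (sg k). Qed.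

Lemma smoothX {R : realType} (f : R -> R) n :
  smooth f -> smooth (fun x => f x ^+ n).
Proof. by move=> sf k; exact: CdirX (sf k). Qed.

Lemma smooth_cst {R : realType} (c : R) : smooth (fun=> c).
Proof. by move=> k; exact: Cdir_cst. Qed.

Lemma smooth_id {R : realType} : smooth (fun x : R => x).
Proof. by move=> k; exact: Cline_id. Qed.

Lemma smooth_comp {R : realType} (f g : R -> R) :
  smooth f -> smooth g -> smooth (fun x => f (g x)).
Proof. by move=> sf sg k; exact: (Cdir_comp (sf k) (sg k)). Qed.

Lemma smooth_inv {R : realType} (f : R -> R) :
  (forall x, 0 < f x) -> smooth f -> smooth (fun x => (f x)^-1).
Proof.
move=> f0 sf k; have ci : Cline k [set y : R | 0 < y] (fun y => y^-1).
  by apply: Cline_inv => x /= x0; rewrite gt_eqF.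
by apply: (Cdir_comp ci (sf k)) => x _; exact: f0.
Qed.

Lemma smooth_sqrt {R : realType} (f : R -> R) :
  (forall x, 0 < f x) -> smooth f -> smooth (fun x => Num.sqrt (f x)).
Proof.
by move=> f0 sf k; apply: (Cdir_comp (Cline_sqrt (R := R) k) (sf k)) => x _; exact: f0.
Qed.

Lemma smooth_ln {R : realType} (f : R -> R) :
  (forall x, 0 < f x) -> smooth f -> smooth (fun x => ln (f x)).
Proof.
by move=> f0 sf k; apply: (Cdir_comp (Cline_ln (R := R) k) (sf k)) => x _; exact: f0.
Qed.

Lemma smooth_sin {R : realType} (f : R -> R) : smooth f -> smooth (fun x => sin (f x)).
Proof. by apply: smooth_comp => k; case: (@Cline_sincos R k setT). Qed.

Lemma smooth_cos {R : realType} (f : R -> R) : smooth f -> smooth (fun x => cos (f x)).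
Proof. by apply: smooth_comp => k; case: (@Cline_sincos R k setT). Qed.

Lemma smooth_horner {R : realType} (p : {poly R}) : smooth (horner p).
Proof. by move=> k; exact: Cline_horner. Qed.

(** Composition with [zeta] turns functions that are well behaved only near [0, 1] into smooth
    functions on the whole line without changing them near [0, 1]. The distance to the midpoint 1/2
    is multiplied by a cutoff built from [flat 1]. *)
Lemma smooth_retraction {R : realType} (d : R) : 0 < d ->
  exists2 zeta : R -> R,
    smooth zeta /\ (forall s, - d < zeta s < 1 + d) &
    forall s, - (d / 2) < s < 1 + d / 2 -> zeta s = s.
Proof.
move=> d0.
set c : R := (1 / 2 + d / 2) ^+ 2; set b : R := (1 / 2 + d) ^+ 2.
have cb : c < b by rewrite /c /b ltrXn2r//; lra.
pose q (s : R) := (s - 1 / 2) ^+ 2.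
pose N s := flat 1 (b - q s); pose M s := flat 1 (q s - c).
have NM0 s : 0 < N s + M s.
  have [h|h] := ltP (q s) b.
    by rewrite ltr_pwDl ?flat1_ge0// flat1_gt0// subr_gt0.
  by rewrite ltr_wpDl ?flat1_ge0// flat1_gt0// subr_gt0; exact: lt_le_trans h.
pose zeta s := 1 / 2 + (s - 1 / 2) * (N s / (N s + M s)).
have sq : smooth q by apply: smoothX; apply: smoothB; [exact: smooth_id|exact: smooth_cst].
have sN : smooth N.
  by apply: smooth_comp; [exact: smooth_flat|apply: smoothB => //; exact: smooth_cst].
have sM : smooth M.
  by apply: smooth_comp; [exact: smooth_flat|apply: smoothB => //; exact: smooth_cst].
exists zeta; first split.
- apply: smoothD; first exact: smooth_cst.
  apply: smoothM; first by apply: smoothB; [exact: smooth_id|exact: smooth_cst].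
  by apply: smoothM => //; apply: smooth_inv => //; exact: smoothD.
- move=> s; have r0 : 0 <= N s / (N s + M s) by rewrite divr_ge0 ?flat1_ge0// ltW.
  have r1 : N s / (N s + M s) <= 1.
    by rewrite ler_pdivrMr// mul1r lerDl flat1_ge0.
  have [h|h] := ltP (q s) b.
    have /andP[l u] : - (1 / 2 + d) < s - 1 / 2 < 1 / 2 + d.
      by rewrite -ltr_norml -(ltr_pXn2r (n := 2)) ?nnegrE ?real_normK ?num_real//; lra.
    rewrite /zeta; move: (N s / _) r0 r1 => r r0 r1; nra.
  have N0 : N s = 0 by rewrite /N flat_le0// subr_le0.
  by rewrite /zeta N0 mul0r mulr0; lra.
- move=> s /andP[l u].
  have M0 : M s = 0 by rewrite /M flat_le0// subr_le0 /c /q; nra.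
  have Ns : N s != 0 by have := NM0 s; rewrite M0 addr0; exact: lt0r_neq0.
  by rewrite /zeta M0 addr0 divff// mulr1; lra.
Qed.

Lemma smooth_continuous {R : realType} (h : R -> R) : smooth h -> continuous h.
Proof. by move=> sh x; exact: Cdir_cont (sh 0%N) _. Qed.

(** The integral from the base point [a]; the fundamental theorem applies to the right of it, hence
    the half-line. *)
Lemma antiderivative {R : realType} (j : R -> R) (a : R) : smooth j ->
  exists2 J : R -> R, (forall k, Cline k [set x | a < x] J) &
    forall x, a < x -> is_derive x 1 J (j x).
Proof.
move=> sj; have cj := smooth_continuous sj.
pose J (x : R) : R := (\int[lebesgue_measure]_(t in `[a, x]) j t)%R.
have dJ x : a < x -> is_derive x 1 J (j x).
  move=> ax.
  have ij : (@lebesgue_measure R).-integrable `[a, x + 1] (EFin \o j).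
    apply: continuous_compact_integrable; first exact: segment_compact.
    by apply: continuous_subspaceT => y; exact: cj.
  have xu : x < x + 1 by rewrite ltrDl.
  have [d e] := continuous_FTC1_closed xu ij ax (cj x).
  by apply: DeriveDef d _; exact: etrans (esym (derive1E J x)) e.
exists J => //; apply: (@Cline_self _ _ _ j) => // k _.
by apply: Cdir_sub (sj k).
Qed.

(** * Curves with prescribed Gram data *)

Lemma horner_min01 {R : realType} (p : {poly R}) :
  (forall z, 0 <= z <= 1 -> 0 < p.[z]) ->
  exists2 c, 0 < c & forall z, 0 <= z <= 1 -> c <= p.[z].
Proof.
move=> p0.
have cp : {within `[0, 1], continuous (horner p)}.
  by apply: continuous_subspaceT => z; exact: continuous_horner.
have [c c01 cm] := EVT_min ler01 cp.
exists p.[c]; first by apply: p0; rewrite in_itv in c01.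
by move=> z z01; apply: cm; rewrite in_itv.
Qed.

Lemma horner_max01 {R : realType} (p : {poly R}) :
  exists M, forall z, 0 <= z <= 1 -> p.[z] <= M.
Proof.
have cp : {within `[0, 1], continuous (horner p)}.
  by apply: continuous_subspaceT => z; exact: continuous_horner.
have [c _ cm] := EVT_max ler01 cp.
by exists p.[c] => z z01; apply: cm; rewrite in_itv.
Qed.

Lemma horner_gt0_nbhs {R : realType} (p : {poly R}) :
  (forall z, 0 <= z <= 1 -> 0 < p.[z]) ->
  exists2 d, 0 < d & forall z, - d < z < 1 + d -> 0 < p.[z].
Proof.
move=> p0.
have near_gt0 (x : R) : 0 < p.[x] -> exists2 d, 0 < d &
    forall z, `|x - z| < d -> 0 < p.[z].
  move=> px; have /cvgrPdist_lt/(_ _ px)[d /= d0 dp] := @continuous_horner _ p x.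
  exists d => // z /dp; rewrite ltr_distlC => /andP[+ _].
  by rewrite subrr.
have [|d d0 dp] := near_gt0 0; first by apply: p0; rewrite lexx ler01.
have [|d' d'0 d'p] := near_gt0 1; first by apply: p0; rewrite lexx ler01.
exists (Num.min d d'); first by rewrite lt_min d0.
move=> z; rewrite ltrNl -ltrBlDl !lt_min => /andP[/andP[h1 h2] /andP[h3 h4]].
have [z0|z0] := ltP z 0.
  by apply: dp; rewrite sub0r normrN ltr0_norm//.
have [z1|z1] := ltP 1 z.
  by apply: d'p; rewrite distrC gtr0_norm// subr_gt0.
by apply: p0; rewrite z0.
Qed.

Lemma is_derive_near_inj {R : realType} (f g : R -> R) (z df dg : R) :
  (\near z, f z = g z) -> is_derive z 1 f df -> is_derive z 1 g dg -> df = dg.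
Proof.
by move=> fg hf [_ <-]; have [_ <-] := near_eq_is_derive fg hf.
Qed.

Lemma near_oo {R : realType} (a b z : R) : a < z < b -> \near z, a < z < b.
Proof.
move=> zab; have : z \in `]a, b[ by rewrite in_itv.
by move=> /near_in_itvoo; apply: filterS => y; rewrite in_itv.
Qed.

(** The first term is at least 2 d0, while the two subtracted ones together are at most s (M + 4 M +
    M^2) <= d0. *)
Lemma radicand_gt0 {R : realType} (s M d0 b v i u r : R) :
  0 < s -> s <= 1 -> s * (M + 4 * M + M * M) <= d0 -> 0 < d0 ->
  0 <= b <= M -> 0 <= v <= M -> 0 <= i <= M -> d0 <= u -> 1 / 2 <= r <= 1 ->
  0 < 4 * r * u - s * (b + 4 * i) * r - s * s * v * i.
Proof.
move=> s0 s1 sc d00 /andP[b0 bM] /andP[v0 vM] /andP[i_0 iM] ud /andP[r1 r2].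
have h1 : 2 * d0 <= 4 * r * u by apply: ler_pM; lra.
have h2 : s * (b + 4 * i) * r <= s * (M + 4 * M) * 1.
  apply: ler_pM => //; [by apply: mulr_ge0; lra|lra|].
  by rewrite ler_pM2l//; lra.
have h3 : s * s * v * i <= s * 1 * M * M.
  by rewrite !(mulr_ge0, ler_pM)// ?ler_pM2l// ltW.
lra.
Qed.

Lemma sub_margin {R : realType} (d d' z : R) :
  d <= d' -> - d < z < 1 + d -> - d' < z < 1 + d'.
Proof. by move=> dd /andP[h1 h2]; apply/andP; split; lra. Qed.

(* [1 - s (I + z^2)] is the squared radius left for the pair [(W1, W2)] of
   [gram_curve], and [Rp / (4 I rho2^2)] the squared angular velocity which that
   pair needs in order to reach the total speed [La]. *)
Lemma gram_radicand {R : realType} (La ka I : {poly R}) :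
  (forall z : R, 0 <= z <= 1 -> 0 < I.[z]) ->
  (forall z : R, 0 <= z <= 1 -> ka.[z] ^+ 2 < I.[z] * La.[z]) ->
  exists (s d : R) (rho2 Rp : {poly R}),
  [/\ 0 < s, 0 < d <= 1,
      forall z : R, - d < z < 1 + d -> [/\ 0 < I.[z], 0 < rho2.[z] & 0 < Rp.[z]],
      forall z, rho2.[z] = 1 - s * (I.[z] + z * z) /\
                rho2^`().[z] = - s * (I^`().[z] + 2 * z) &
      forall z, Rp.[z] = 4 * rho2.[z] * (I.[z] * La.[z] - ka.[z] ^+ 2)
        - s * (I^`().[z] * I^`().[z] + 4 * I.[z]) * rho2.[z]
        - s * s * ((I^`().[z] + 2 * z) * (I^`().[z] + 2 * z)) * I.[z]].
Proof.
move=> I0 det.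
pose D := I * La - ka ^+ 2.
have D0 z : 0 <= z <= 1 -> 0 < D.[z].
  by move=> /det; rewrite /D !(hornerD, hornerN, hornerM) subr_gt0 expr2.
have [d0 d00 Dd] := horner_min01 D0.
have [M1 IM] := horner_max01 (I + 'X * 'X).
have [M2 dIM] := horner_max01 (I^`() * I^`()).
pose I2 := I^`() + 2%:P * 'X.
have [M3 I2M] := horner_max01 (I2 * I2).
pose M := 1 + `|M1| + `|M2| + `|M3|.
have M10 : 1 <= M by rewrite /M -!addrA lerDl !addr_ge0.
have M0 : 0 < M by apply: lt_le_trans M10.
have M1M : M1 <= M by have := ler_norm M1; rewrite /M; have := normr_ge0 M2; have := normr_ge0 M3; lra.
have M2M : M2 <= M by have := ler_norm M2; rewrite /M; have := normr_ge0 M1; have := normr_ge0 M3; lra.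
have M3M : M3 <= M by have := ler_norm M3; rewrite /M; have := normr_ge0 M2; have := normr_ge0 M1; lra.
pose c := M + 4 * M + M * M.
have c0 : 0 < c by rewrite /c; nra.
(* The first bound keeps [rho2] at least 1/2 on [0, 1], the second makes the terms subtracted in
   [Rp] smaller than the determinant term. *)
pose s := Num.min (1 / (2 * M)) (d0 / c).
have s0 : 0 < s by rewrite lt_min !divr_gt0 ?mulr_gt0.
have sM : s * M <= 1 / 2.
  have : s <= 1 / (2 * M) by rewrite ge_min lexx.
  by rewrite ler_pdivlMr ?mulr_gt0//; lra.
have sc : s * c <= d0.
  have : s <= d0 / c by rewrite ge_min lexx orbT.
  by rewrite ler_pdivlMr.
pose rho2 := 1%:P - s%:P * (I + 'X * 'X).
pose Rp := 4%:P * rho2 * D - s%:P * (I^`() * I^`() + 4%:P * I) * rho2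
  - (s * s)%:P * (I2 * I2) * I.
have rhoE (z : R) : rho2.[z] = 1 - s * (I.[z] + z * z).
  by rewrite /rho2 !(hornerD, hornerN, hornerM, hornerC, hornerX).
have I2E (z : R) : I2.[z] = I^`().[z] + 2 * z.
  by rewrite /I2 !(hornerD, hornerN, hornerM, hornerC, hornerX).
have DE (z : R) : D.[z] = I.[z] * La.[z] - ka.[z] ^+ 2.
  by rewrite /D !(hornerD, hornerN, hornerM) expr2.
have RpE (z : R) : Rp.[z] = 4 * rho2.[z] * D.[z]
    - s * (I^`().[z] * I^`().[z] + 4 * I.[z]) * rho2.[z]
    - s * s * (I2.[z] * I2.[z]) * I.[z].
  have gen (r u v i b : {poly R}) : (4%:P * r * u - s%:P * (b * b + 4%:P * i) * r
      - (s * s)%:P * (v * v) * i).[z] = 4 * r.[z] * u.[z]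
      - s * (b.[z] * b.[z] + 4 * i.[z]) * r.[z] - s * s * (v.[z] * v.[z]) * i.[z].
    by rewrite !(hornerD, hornerN, hornerM, hornerC).
  exact: gen.
have IM' (z : R) : 0 <= z <= 1 -> I.[z] + z * z <= M.
  move=> z01; have := IM z z01; rewrite !(hornerD, hornerM, hornerX) => h.
  exact: le_trans h M1M.
have dIM' (z : R) : 0 <= z <= 1 -> I^`().[z] * I^`().[z] <= M.
  by move=> z01; have := dIM z z01; rewrite hornerM => h; exact: le_trans h M2M.
have I2M' (z : R) : 0 <= z <= 1 -> I2.[z] * I2.[z] <= M.
  by move=> z01; have := I2M z z01; rewrite hornerM => h; exact: le_trans h M3M.
have cE : c = M + 4 * M + M * M by [].
clearbody M c s.
have s1 : s <= 1 by nra.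
have rho_ge z : 0 <= z <= 1 -> 1 / 2 <= rho2.[z] <= 1.
  move=> z01; have := IM' z z01; have := I0 z z01.
  have /andP[z0 z1] := z01; rewrite rhoE => Iz Mz.
  have zz : 0 <= z * z by exact: mulr_ge0.
  have : s * (I.[z] + z * z) <= s * M by rewrite ler_pM2l.
  have : 0 <= s * (I.[z] + z * z) by apply: mulr_ge0; lra.
  by move=> h1 h2; apply/andP; split; lra.
have rho0 z : 0 <= z <= 1 -> 0 < rho2.[z] by move=> /rho_ge/andP[h _]; lra.
have Rp0 z : 0 <= z <= 1 -> 0 < Rp.[z].
  move=> z01; rewrite RpE.
  have := rho_ge z z01; have := IM' z z01; have := dIM' z z01; have := I2M' z z01.
  have := Dd z z01; have := I0 z z01; have /andP[z0 z1] := z01.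
  have zz : 0 <= z * z by exact: mulr_ge0.
  have b0 : 0 <= I^`().[z] * I^`().[z] by exact: sqr_ge0.
  have v0 : 0 <= I2.[z] * I2.[z] by exact: sqr_ge0.
  move=> i_0 ud vM bM iM r12.
  have iM' : I.[z] <= M by apply: le_trans iM; rewrite lerDl.
  apply: (@radicand_gt0 _ s M d0) => //.
  - by rewrite -cE.
  - exact/andP.
  - exact/andP.
  - by rewrite (ltW i_0).
have [d1 d10 Id] := horner_gt0_nbhs I0.
have [d2 d20 rd] := horner_gt0_nbhs rho0.
have [d3 d30 Rd] := horner_gt0_nbhs Rp0.
pose d := Num.min (Num.min d1 d2) (Num.min d3 1).
have dpos : 0 < d by rewrite !lt_min d10 d20 d30 ltr01.
have [dd1 dd2 dd3 dd4] : [/\ d <= d1, d <= d2, d <= d3 & d <= 1].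
  by rewrite !ge_min; split; rewrite lexx ?orbT.
clearbody d.
exists s, d, rho2, Rp; split=> [//||z zd|z|z].
- by rewrite dpos dd4.
- split; [apply: Id|apply: rd|apply: Rd]; exact: sub_margin zd.
- split=> //; rewrite /rho2 derivB derivM !derivC derivD derivM derivX.
  by rewrite !(hornerD, hornerN, hornerM, hornerC, hornerX); ring.
- by rewrite RpE DE I2E.
Qed.

Lemma polar_sqr_sum {R : realType} (a a' t c s : R) : c ^+ 2 + s ^+ 2 = 1 ->
  (a' * c + a * (- s * t)) ^+ 2 + (a' * s + a * (c * t)) ^+ 2 =
  a' ^+ 2 + a ^+ 2 * t ^+ 2.
Proof.
move=> h; transitivity ((a' ^+ 2 + a ^+ 2 * t ^+ 2) * (c ^+ 2 + s ^+ 2)); first ring.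
by rewrite h mulr1.
Qed.

Lemma polar_cross {R : realType} (a a' t c s : R) : c ^+ 2 + s ^+ 2 = 1 ->
  a * c * (a' * s + a * (c * t)) - a * s * (a' * c + a * (- s * t)) = a ^+ 2 * t.
Proof.
move=> h; transitivity (a ^+ 2 * t * (c ^+ 2 + s ^+ 2)); first ring.
by rewrite h mulr1.
Qed.

Lemma polar_sqr {R : realType} (a c s : R) : c ^+ 2 + s ^+ 2 = 1 ->
  (a * c) ^+ 2 + (a * s) ^+ 2 = a ^+ 2.
Proof.
move=> h; transitivity (a ^+ 2 * (c ^+ 2 + s ^+ 2)); first ring.
by rewrite h mulr1.
Qed.

(* The functions [e * z], [W1], [W2] and the complex function [A + i B] are the
   components of a curve on the unit sphere; [A + i B] is later rotated with
   angular velocity [e^-1], and [La], [ka], [I] are the nontrivial entries of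
   the Gram matrix of the velocity and of the rotation field along the curve. *)
Lemma gram_curve {R : realType} (La ka I : {poly R}) :
  (forall z : R, 0 <= z <= 1 -> 0 < I.[z]) ->
  (forall z : R, 0 <= z <= 1 -> ka.[z] ^+ 2 < I.[z] * La.[z]) ->
  exists (e d : R) (W1 W2 A B : R -> R),
  [/\ 0 < e /\ 0 < d,
      [/\ smooth W1, smooth W2, smooth A & smooth B] &
      forall z : R, - d < z < 1 + d ->
      [/\ (e * z) ^+ 2 + W1 z ^+ 2 + W2 z ^+ 2 + A z ^+ 2 + B z ^+ 2 = 1,
          A z ^+ 2 + B z ^+ 2 = e ^+ 2 * I.[z],
          A z * 'D_1 B z - B z * 'D_1 A z = e * ka.[z] &
          e ^+ 2 + 'D_1 W1 z ^+ 2 + 'D_1 W2 z ^+ 2 + 'D_1 A z ^+ 2 + 'D_1 B z ^+ 2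
            = La.[z]]].
Proof.
move=> I0 det.
have [s [d [rho2 [Rp [s0 /andP[dpos d1] pos rhoE RpE]]]]] := gram_radicand I0 det.
(* With e^2 = s, the sphere equation reads rho2 + e^2 (I + z^2) = 1. *)
pose e := Num.sqrt s.
have e0 : 0 < e by rewrite sqrtr_gt0.
have es : e ^+ 2 = s by rewrite sqr_sqrtr// ltW.
have [zeta [szeta zd] zid] := smooth_retraction dpos.
have sp (p : {poly R}) : smooth (fun x => p.[zeta x]).
  by apply: smooth_comp szeta; exact: smooth_horner.
have It x : 0 < I.[zeta x] by have [] := pos _ (zd x).
have rt x : 0 < rho2.[zeta x] by have [] := pos _ (zd x).
have Rt x : 0 < Rp.[zeta x] by have [] := pos _ (zd x).
pose g x := e * Num.sqrt I.[zeta x].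
pose rho x := Num.sqrt rho2.[zeta x].
have sg : smooth g by apply: smoothM; [exact: smooth_cst|exact: smooth_sqrt].
have srho : smooth rho by exact: smooth_sqrt.
(* The angular velocity of (A, B), determined by g^2 j1 = e ka; [j2] is that of (W1, W2). *)
pose j1 x := ka.[zeta x] * (e * I.[zeta x])^-1.
have sj1 : smooth j1.
  apply: smoothM => //; apply: smooth_inv => [x|]; first exact: mulr_gt0.
  by apply: smoothM => //; exact: smooth_cst.
pose j2 x := Num.sqrt (Rp.[zeta x] * (4 * I.[zeta x])^-1) * (rho2.[zeta x])^-1.
have sj2 : smooth j2.
  apply: smoothM; last exact: smooth_inv.
  apply: smooth_sqrt => [x|]; first by rewrite mulr_gt0 ?invr_gt0 ?mulr_gt0.
  apply: smoothM => //; apply: smooth_inv => [x|]; first exact: mulr_gt0.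
  by apply: smoothM => //; exact: smooth_cst.
have [J1 sJ1 dJ1] := antiderivative (-1) sj1.
have [J2 sJ2 dJ2] := antiderivative (-1) sj2.
(* The bound d <= 1 keeps [zeta] to the right of the base point -1 of the two antiderivatives. *)
have z1 x : -1 < zeta x by have /andP[h _] := zd x; apply: le_lt_trans h; rewrite lerN2.
pose th1 x := J1 (zeta x); pose th2 x := J2 (zeta x).
have sth1 : smooth th1 by move=> k; apply: (Cdir_comp (sJ1 k) (szeta k)) => x _; exact: z1.
have sth2 : smooth th2 by move=> k; apply: (Cdir_comp (sJ2 k) (szeta k)) => x _; exact: z1.
exists e, (d / 2), (fun x => rho x * cos (th2 x)), (fun x => rho x * sin (th2 x)),
  (fun x => g x * cos (th1 x)), (fun x => g x * sin (th1 x)).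
split; first by split=> //; lra.
  by split; apply: smoothM => //; first [exact: smooth_cos|exact: smooth_sin].
move=> z zn; have zz := zid z zn.
have zd' : - d < z < 1 + d by apply: sub_margin zn; lra.
have [Iz rz Rz] := pos z zd'.
have dz : is_derive z 1 zeta 1.
  apply: (@near_eq_is_derive _ _ _ id) (is_derive_id _ _).
  by apply: filterS (near_oo zn) => y /zid ->.
have dp (p : {poly R}) : is_derive z 1 (fun x => p.[zeta x]) p^`().[z].
  have := is_derive_comp_fun (is_derive_poly p (zeta z)) dz.
  by rewrite zz mulr1.
have dsqrt (p : {poly R}) : 0 < p.[z] ->
    is_derive z 1 (fun x => Num.sqrt p.[zeta x]) (p^`().[z] / (2 * Num.sqrt p.[z])).
  move=> pz; have pz' : 0 < p.[zeta z] by rewrite zz.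
  have := @is_derive_comp_fun _ _ Num.sqrt (fun x => p.[zeta x]) z 1 _ _
    (is_derive1_sqrt pz') (dp p).
  by rewrite zz mulrC.
have dth1 : is_derive z 1 th1 (j1 z).
  by have := is_derive_comp_fun (dJ1 _ (z1 z)) dz; rewrite zz mulr1.
have dth2 : is_derive z 1 th2 (j2 z).
  by have := is_derive_comp_fun (dJ2 _ (z1 z)) dz; rewrite zz mulr1.
have dg : is_derive z 1 g (0 * Num.sqrt I.[zeta z] + e * (I^`().[z] / (2 * Num.sqrt I.[z]))).
  exact: is_deriveM_fun (is_derive_cst _ _ _) (dsqrt I Iz).
have drho := dsqrt rho2 rz.
have dsin (t : R -> R) t' : is_derive z 1 t t' ->
    is_derive z 1 (fun x => sin (t x)) (cos (t z) * t').
  by move=> dt; exact: is_derive_comp_fun (is_derive_sin _) dt.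
have dcos (t : R -> R) t' : is_derive z 1 t t' ->
    is_derive z 1 (fun x => cos (t x)) (- sin (t z) * t').
  by move=> dt; exact: is_derive_comp_fun (is_derive_cos _) dt.
have [_ ->] := is_deriveM_fun drho (dcos _ _ dth2).
have [_ ->] := is_deriveM_fun drho (dsin _ _ dth2).
have [_ ->] := is_deriveM_fun dg (dcos _ _ dth1).
have [_ ->] := is_deriveM_fun dg (dsin _ _ dth1).
have [rE drhoE] := rhoE z; have RE := RpE z.
rewrite drhoE /g /rho /j1 /j2 !zz.
have cs1 := cos2Dsin2 (th1 z); have cs2 := cos2Dsin2 (th2 z).
have r2 : Num.sqrt I.[z] ^+ 2 = I.[z] by rewrite sqr_sqrtr// ltW.
have q2 : Num.sqrt rho2.[z] ^+ 2 = rho2.[z] by rewrite sqr_sqrtr// ltW.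
have t2 : Num.sqrt (Rp.[z] / (4 * I.[z])) ^+ 2 = Rp.[z] / (4 * I.[z]).
  by rewrite sqr_sqrtr// ltW// divr_gt0// mulr_gt0.
have r0 : 0 < Num.sqrt I.[z] by rewrite sqrtr_gt0.
have q0 : 0 < Num.sqrt rho2.[z] by rewrite sqrtr_gt0.
move: (Num.sqrt I.[z]) (Num.sqrt rho2.[z]) (Num.sqrt (Rp.[z] / (4 * I.[z]))) r2 q2 t2 r0 q0.
move=> r q t r2 q2 t2 r0 q0.
have r0' : r != 0 by rewrite gt_eqF.
have q0' : q != 0 by rewrite gt_eqF.
have e0' : e != 0 by rewrite gt_eqF.
split.
- rewrite -addrA polar_sqr// -(addrA (_ ^+ 2)) polar_sqr// q2 rE [(e * r) ^+ 2]exprMn r2 exprMn es; ring.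
- by rewrite polar_sqr// exprMn r2.
- by rewrite polar_cross// exprMn -r2; field; rewrite ?r0' ?e0'.
- rewrite -addrA polar_sqr_sum// -(addrA (_ ^+ 2)) polar_sqr_sum//.
  rewrite [(t * _) ^+ 2]exprMn t2 RE -r2 -q2 -es.
  by field; rewrite ?r0' ?q0' ?e0'.
Qed.

(** * Profile equations along the curve *)

(* In three space dimensions [Box] maps [t^-a H(|x|^2 / t^2)] to
   [t^(-a - 2) (profile_box a H)(|x|^2 / t^2)]; [rot_box a w A B] is the real part
   of the profile obtained from [t^(-a + i w) (A + i B)(|x|^2 / t^2)]. *)
Definition profile_box {R : realType} (a : R) (H : R -> R) (z : R) : R :=
  4 * z * (1 - z) * 'D_1 ('D_1 H) z + (6 - (6 + 4 * a) * z) * 'D_1 H z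
  - a * (a + 1) * H z.

Definition rot_box {R : realType} (a w : R) (A B : R -> R) (z : R) : R :=
  profile_box a A z + w ^+ 2 * A z - w * (4 * z * 'D_1 B z + (2 * a + 1) * B z).

Lemma is_derive_sqr_fun {R : realType} (f : R -> R) (x df : R) :
  is_derive x 1 f df -> is_derive x 1 (fun y => f y ^+ 2) (2 * f x * df).
Proof.
move=> hf; have := is_deriveM_fun hf hf.
rewrite (_ : df * f x + f x * df = 2 * f x * df); first by [].
by ring.
Qed.

Lemma smooth_profile_box {R : realType} (a : R) (H : R -> R) :
  smooth H -> smooth (profile_box a H).
Proof.
move=> sH.
have c (r : R) : smooth (fun=> r) by exact: smooth_cst.
have i : smooth (fun z : R => z) by exact: smooth_id.
apply: smoothB; [apply: smoothD; apply: smoothM|exact: smoothM].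
- by do ![apply: smoothM => //]; exact: smoothB.
- by do 2!apply: smooth_derive.
- by apply: smoothB => //; exact: smoothM.
- exact: smooth_derive.
Qed.

Lemma smooth_rot_box {R : realType} (a w : R) (A B : R -> R) :
  smooth A -> smooth B -> smooth (rot_box a w A B).
Proof.
move=> sA sB.
have c (r : R) : smooth (fun=> r) by exact: smooth_cst.
have i : smooth (fun z : R => z) by exact: smooth_id.
apply: smoothB; first by apply: smoothD; [exact: smooth_profile_box|exact: smoothM].
apply: smoothM => //; apply: smoothD; last exact: smoothM.
by apply: smoothM; [exact: smoothM|exact: smooth_derive].
Qed.

Lemma is_derive_mull_fun {R : realType} (e x : R) : is_derive x 1 ( *%R e) e.
Proof.
have := is_deriveM_fun (is_derive_cst e x 1) (is_derive_id x 1).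
by rewrite mul0r add0r mulr1.
Qed.

(** The Gram relations hold on an open interval, so both sides may be differentiated there. The
    second conclusion comes from differentiating the first and recognising the squared speed
    [La]. *)
Lemma gram_curve_derivatives {R : realType} (La ka I : {poly R}) (e d : R)
    (W1 W2 A B dW1 dW2 dA dB ddW1 ddW2 ddA ddB : R -> R) :
  (forall x : R, is_derive x 1 W1 (dW1 x)) -> (forall x : R, is_derive x 1 dW1 (ddW1 x)) ->
  (forall x : R, is_derive x 1 W2 (dW2 x)) -> (forall x : R, is_derive x 1 dW2 (ddW2 x)) ->
  (forall x : R, is_derive x 1 A (dA x)) -> (forall x : R, is_derive x 1 dA (ddA x)) ->
  (forall x : R, is_derive x 1 B (dB x)) -> (forall x : R, is_derive x 1 dB (ddB x)) ->
  (forall z : R, - d < z < 1 + d ->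
      [/\ (e * z) ^+ 2 + W1 z ^+ 2 + W2 z ^+ 2 + A z ^+ 2 + B z ^+ 2 = 1,
          A z ^+ 2 + B z ^+ 2 = e ^+ 2 * I.[z],
          A z * dB z - B z * dA z = e * ka.[z] &
          e ^+ 2 + dW1 z ^+ 2 + dW2 z ^+ 2 + dA z ^+ 2 + dB z ^+ 2
            = La.[z]]) ->
  forall z : R, - d < z < 1 + d ->
  [/\ e * z * e + W1 z * dW1 z + W2 z * dW2 z + A z * dA z + B z * dB z = 0,
      La.[z] + W1 z * ddW1 z + W2 z * ddW2 z
        + A z * ddA z + B z * ddB z = 0,
      2 * (A z * dA z + B z * dB z) = e ^+ 2 * I^`().[z],
      A z * ddB z - B z * ddA z = e * ka^`().[z] &
      2 * (dW1 z * ddW1 z + dW2 z * ddW2 z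
        + dA z * ddA z + dB z * ddB z) = La^`().[z]].
Proof.
move=> hW1 hdW1 hW2 hdW2 hA hdA hB hdB gram.
have Dp (c : R) (p : {poly R}) (y : R) : is_derive y 1 (fun x => c * p.[x]) (c * p^`().[y]).
  by have := is_deriveM_fun (is_derive_cst c y 1) (is_derive_poly p y); rewrite mul0r add0r.
have near_eq (f g : R -> R) (z df dg : R) : - d < z < 1 + d ->
    (forall y : R, - d < y < 1 + d -> f y = g y) ->
    is_derive z 1 f df -> is_derive z 1 g dg -> df = dg.
  move=> zN fg; apply: is_derive_near_inj.
  by apply: filterS (near_oo zN) => y /fg.
have d1 (y : R) : - d < y < 1 + d ->
    e * y * e + W1 y * dW1 y + W2 y * dW2 y + A y * dA y + B y * dB y = 0.
  move=> yN.
  have h := near_eq _ (fun=> 1) y _ _ yN _ (is_deriveD_fun (is_deriveD_fun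
    (is_deriveD_fun (is_deriveD_fun
    (is_derive_sqr_fun (is_derive_mull_fun e y)) (is_derive_sqr_fun (hW1 y)))
    (is_derive_sqr_fun (hW2 y))) (is_derive_sqr_fun (hA y)))
    (is_derive_sqr_fun (hB y))) (is_derive_cst (1 : R) y 1).
  have {h} := h (fun x xN => let: And4 g _ _ _ := gram x xN in g); lra.
move=> z zN; split; first exact: d1.
- have := near_eq _ (fun=> 0) z _ _ zN _ (is_deriveD_fun (is_deriveD_fun
    (is_deriveD_fun (is_deriveD_fun
    (is_deriveM_fun (is_derive_mull_fun e z) (is_derive_cst e z 1))
    (is_deriveM_fun (hW1 z) (hdW1 z)))
    (is_deriveM_fun (hW2 z) (hdW2 z)))
    (is_deriveM_fun (hA z) (hdA z)))
    (is_deriveM_fun (hB z) (hdB z))) (is_derive_cst (0 : R) z 1) => /(_ d1).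
  by have [_ _ _ <-] := gram z zN => h; rewrite -[RHS]h /cst; ring.
- have h := near_eq _ _ z _ _ zN _ (is_deriveD_fun (is_derive_sqr_fun (hA z))
    (is_derive_sqr_fun (hB z))) (Dp (e ^+ 2) I z).
  have <- := h (fun x xN => let: And4 _ g _ _ := gram x xN in g); ring.
- have h := near_eq _ _ z _ _ zN _ (is_deriveD_fun (is_deriveM_fun (hA z) (hdB z))
    (is_deriveN_fun (is_deriveM_fun (hB z) (hdA z)))) (Dp e ka z).
  have <- := h (fun x xN => let: And4 _ _ g _ := gram x xN in g); ring.
- have h := near_eq _ _ z _ _ zN _ (is_deriveD_fun (is_deriveD_fun
    (is_deriveD_fun (is_deriveD_fun (is_derive_cst (e ^+ 2) z 1)
    (is_derive_sqr_fun (hdW1 z))) (is_derive_sqr_fun (hdW2 z)))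
    (is_derive_sqr_fun (hdA z))) (is_derive_sqr_fun (hdB z)))
    (is_derive_poly La z).
  have <- := h (fun x xN => let: And4 _ _ _ g := gram x xN in g); ring.
Qed.

(** The conclusions compute the inner products of the profile of Box u with J U (up to a factor e),
    U and U'. Each regroups into the Gram relations and their derivatives, after which the scalar
    identities of [gram_polys] finish. *)
Lemma profile_algebra {R : realType} (a e z i i' k k' L L' v
    w dw ddw y dy ddy A dA ddA B dB ddB : R) :
  e != 0 ->
  (e * z) ^+ 2 + w ^+ 2 + y ^+ 2 + A ^+ 2 + B ^+ 2 = 1 ->
  A ^+ 2 + B ^+ 2 = e ^+ 2 * i ->
  A * dB - B * dA = e * k ->
  e ^+ 2 + dw ^+ 2 + dy ^+ 2 + dA ^+ 2 + dB ^+ 2 = L ->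
  e * z * e + w * dw + y * dy + A * dA + B * dB = 0 ->
  L + w * ddw + y * ddy + A * ddA + B * ddB = 0 ->
  2 * (A * dA + B * dB) = e ^+ 2 * i' ->
  A * ddB - B * ddA = e * k' ->
  2 * (dw * ddw + dy * ddy + dA * ddA + dB * ddB) = L' ->
  4 * z * (1 - z) * k' + (6 - 6 * z - 4 * a * z) * k + 2 * z * i' + (2 * a + 1) * i = 0 ->
  v = i - 4 * z * (1 - z) * L - 4 * z * k - a * (a + 1) ->
  let X h dh ddh := 4 * z * (1 - z) * ddh + (6 - (6 + 4 * a) * z) * dh - a * (a + 1) * h in
  let XA := X A dA ddA + e^-1 ^+ 2 * A - e^-1 * (4 * z * dB + (2 * a + 1) * B) in
  let XB := X B dB ddB + e^-1 ^+ 2 * B + e^-1 * (4 * z * dA + (2 * a + 1) * A) in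
  [/\ A * XB = B * XA,
      X (e * z) e 0 * (e * z) + X w dw ddw * w + X y dy ddy * y + (XA * A + XB * B) = v &
      X (e * z) e 0 * e + X w dw ddw * dw + X y dy ddy * dy + (XA * dA + XB * dB)
      = 2 * z * (1 - z) * L' + (6 - 6 * z - 4 * a * z) * L + (2 * a + 1) * k + 1 / 2 * i'].
Proof.
move=> e0 g1 g2 g3 g4 h1 h2 h3 h4 h5 e1 -> X XA XB; split; rewrite /XA /XB /X.
- apply/eqP; rewrite -subr_eq0; apply/eqP.
  transitivity (4 * z * (1 - z) * (A * ddB - B * ddA)
    + (6 - (6 + 4 * a) * z) * (A * dB - B * dA)
    + e^-1 * (2 * z * (2 * (A * dA + B * dB)) + (2 * a + 1) * (A ^+ 2 + B ^+ 2))); first by ring.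
  rewrite h4 g3 h3 g2; transitivity (e * (4 * z * (1 - z) * k'
    + (6 - 6 * z - 4 * a * z) * k + 2 * z * i' + (2 * a + 1) * i)); first by field.
  by rewrite e1 mulr0.
- transitivity (4 * z * (1 - z) * (L + w * ddw + y * ddy + A * ddA + B * ddB - L)
    + (6 - (6 + 4 * a) * z) * (e * z * e + w * dw + y * dy + A * dA + B * dB)
    - a * (a + 1) * ((e * z) ^+ 2 + w ^+ 2 + y ^+ 2 + A ^+ 2 + B ^+ 2)
    + e^-1 ^+ 2 * (A ^+ 2 + B ^+ 2) - e^-1 * (4 * z * (A * dB - B * dA))); first by ring.
  by rewrite h2 h1 g1 g2 g3; field.
- transitivity (2 * z * (1 - z) * (2 * (dw * ddw + dy * ddy + dA * ddA + dB * ddB))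
    + (6 - (6 + 4 * a) * z) * (e ^+ 2 + dw ^+ 2 + dy ^+ 2 + dA ^+ 2 + dB ^+ 2)
    - a * (a + 1) * (e * z * e + w * dw + y * dy + A * dA + B * dB)
    + e^-1 ^+ 2 / 2 * (2 * (A * dA + B * dB))
    + e^-1 * (2 * a + 1) * (A * dB - B * dA)); first by field.
  by rewrite h5 g4 h1 h3 g3; field.
Qed.

(** On the rotating pair Box acts as multiplication by [be]. The last two identities are Euler's
    relation and the chain rule that a potential with value [V] along the curve must satisfy. *)
Lemma profile_exists {R : realType} (a : R) : 0 < a -> a < 1 / 2 ->
  exists (e : R) (W1 W2 A B V be : R -> R),
  [/\ 0 < e, [/\ smooth W1, smooth W2, smooth A & smooth B],
      smooth V /\ (forall z, 0 < V z), smooth be &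
      forall z, 0 <= z <= 1 ->
      [/\ (e * z) ^+ 2 + W1 z ^+ 2 + W2 z ^+ 2 + A z ^+ 2 + B z ^+ 2 = 1,
          rot_box a e^-1 A B z = be z * A z /\
          profile_box a B z + e^-1 ^+ 2 * B z
            + e^-1 * (4 * z * 'D_1 A z + (2 * a + 1) * A z) = be z * B z,
          profile_box a ( *%R e) z * (e * z) + profile_box a W1 z * W1 z
            + profile_box a W2 z * W2 z + be z * (A z ^+ 2 + B z ^+ 2)
            = (2 / a + 2) * V z &
          profile_box a ( *%R e) z * e + profile_box a W1 z * 'D_1 W1 z
            + profile_box a W2 z * 'D_1 W2 z
            + be z * (A z * 'D_1 A z + B z * 'D_1 B z) = 'D_1 V z]].
Proof.
move=> a0 a1.
have [La [ka [I [V [E1 E2 E3 pos]]]]] := gram_polys a0 a1.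
have I0 (z : R) : 0 <= z <= 1 -> 0 < I.[z] by move=> /pos[].
have V0 (z : R) : 0 <= z <= 1 -> 0 < V.[z] by move=> /pos[].
have det (z : R) : 0 <= z <= 1 -> ka.[z] ^+ 2 < I.[z] * La.[z] by move=> /pos[].
have [e [d [W1 [W2 [A [B [[e0 d0] [sW1 sW2 sA sB] gram]]]]]]] := gram_curve I0 det.
have [d1 d10 Id] := horner_gt0_nbhs I0.
have [d2 d20 Vd] := horner_gt0_nbhs V0.
pose d' := Num.min d1 d2.
have d'0 : 0 < d' by rewrite lt_min d10.
have [zeta [szeta zd] zid] := smooth_retraction d'0.
have [dd1 dd2] : d' <= d1 /\ d' <= d2 by rewrite !ge_min; split; rewrite lexx ?orbT.
have It x : 0 < I.[zeta x] by apply: Id; exact: sub_margin (zd x).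
have Vt x : 0 < V.[zeta x] by apply: Vd; exact: sub_margin (zd x).
have sp (p : {poly R}) : smooth (fun x => p.[zeta x]).
  by apply: smooth_comp szeta; exact: smooth_horner.
pose XB z := profile_box a B z + e^-1 ^+ 2 * B z
            + e^-1 * (4 * z * 'D_1 A z + (2 * a + 1) * A z).
have sc (r : R) : smooth (fun=> r) by exact: smooth_cst.
have sXB : smooth XB.
  apply: smoothD; first by apply: smoothD; [exact: smooth_profile_box|exact: smoothM].
  apply: smoothM => //; apply: smoothD; last exact: smoothM.
  apply: smoothM; last exact: smooth_derive.
  by apply: smoothM => //; exact: smooth_id.
(* The profile of Box on the rotating pair turns out to be parallel to (A, B), so the multiplier is
   its inner product with (A, B) over A^2 + B^2 = e^2 I; [zeta] keeps the denominator positive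
   everywhere. *)
pose be z := (A z * rot_box a e^-1 A B z + B z * XB z) * (e ^+ 2 * I.[zeta z])^-1.
exists e, W1, W2, A, B, (fun z => V.[zeta z]), be; split=> //.
- apply: smoothM.
    by apply: smoothD; apply: smoothM => //; exact: smooth_rot_box.
  apply: smooth_inv => [z|]; first by rewrite mulr_gt0// exprn_gt0.
  exact: smoothM.
move=> z z01.
have zn' : - (d' / 2) < z < 1 + d' / 2 by case/andP: z01 => ? ?; apply/andP; split; lra.
have zn : - d < z < 1 + d by case/andP: z01 => ? ?; apply/andP; split; lra.
have zz := zid z zn'.
have dV : 'D_1 (fun z => V.[zeta z]) z = V^`().[z].
  have vz : \near z, V.[z] = V.[zeta z].
    by apply: filterS (near_oo zn') => y /zid ->.
  by have [_ ->] := near_eq_is_derive vz (is_derive_poly V z).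
rewrite dV {dV}.
have De1 : 'D_1 ( *%R e) = (fun=> e).
  by apply/funext => y; have [_ ->] := is_derive_mull_fun e y.
have De2 : 'D_1 ('D_1 ( *%R e)) z = 0 by rewrite De1 derive_cst.
have D0 (f : R -> R) : smooth f -> forall y : R, is_derive y 1 f ('D_1 f y).
  by move=> sf y; exact: smooth_is_derive.
have D1 (f : R -> R) : smooth f -> forall y : R, is_derive y 1 ('D_1 f) ('D_1 ('D_1 f) y).
  by move=> sf; apply: D0; exact: smooth_derive.
have [g1 g2 g3 g4] := gram z zn.
have [h1 h2 h3 h4 h5] :=
  gram_curve_derivatives (D0 _ sW1) (D1 _ sW1) (D0 _ sW2) (D1 _ sW2)
    (D0 _ sA) (D1 _ sA) (D0 _ sB) (D1 _ sB) gram zn.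
rewrite E3; have e1 := E1 z; have e2 := E2 z.
have eI : e ^+ 2 * I.[z] != 0 by rewrite gt_eqF// mulr_gt0 ?exprn_gt0// I0.
have e0' : e != 0 by rewrite gt_eqF.
have [cross sumX sumdX] := profile_algebra e0' g1 g2 g3 g4 h1 h2 h3 h4 h5 e1 e2.
rewrite /be zz -/(XB z).
have RAE : rot_box a e^-1 A B z = 4 * z * (1 - z) * 'D_1 ('D_1 A) z +
    (6 - (6 + 4 * a) * z) * 'D_1 A z - a * (a + 1) * A z
    + e^-1 ^+ 2 * A z - e^-1 * (4 * z * 'D_1 B z + (2 * a + 1) * B z) by [].
have XBE : XB z = 4 * z * (1 - z) * 'D_1 ('D_1 B) z +
    (6 - (6 + 4 * a) * z) * 'D_1 B z - a * (a + 1) * B z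
    + e^-1 ^+ 2 * B z + e^-1 * (4 * z * 'D_1 A z + (2 * a + 1) * A z) by [].
have eE : profile_box a ( *%R e) z = 4 * z * (1 - z) * 0 +
    (6 - (6 + 4 * a) * z) * e - a * (a + 1) * (e * z).
  have De1z : 'D_1 ( *%R e) z = e by have [_ ->] := is_derive_mull_fun e z.
  by rewrite /profile_box De2 De1z.
rewrite -RAE -XBE -eE in cross sumX sumdX.
move: (rot_box a e^-1 A B z) (XB z) cross sumX sumdX => XA Y cross sumX sumdX.
have beA : (A z * XA + B z * Y) / (e ^+ 2 * I.[z]) * A z = XA.
  rewrite mulrAC -g2; apply/(canLR (mulfK _)); first by rewrite g2.
  have -> : (A z * XA + B z * Y) * A z = A z ^+ 2 * XA + B z * (A z * Y) by ring.
  by rewrite cross; ring.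
have beB : (A z * XA + B z * Y) / (e ^+ 2 * I.[z]) * B z = Y.
  rewrite mulrAC -g2; apply/(canLR (mulfK _)); first by rewrite g2.
  have -> : (A z * XA + B z * Y) * B z = A z * (B z * XA) + B z ^+ 2 * Y by ring.
  by rewrite -cross; ring.
move: ((A z * XA + B z * Y) / (e ^+ 2 * I.[z])) beA beB => b beA beB.
split=> //.
- rewrite -sumX; congr (_ + _).
  by rewrite -beA -beB; ring.
- rewrite -sumdX; congr (_ + _).
  by rewrite -beA -beB; ring.
Qed.

(** * The wave operator on self-similar fields *)

Lemma is_derive_coord {R : realType} n (i j : 'I_n) (y : 'rV[R]_n) :
  is_derive y (evec R i) (fun x : 'rV[R]_n => x 0 j) (i == j)%:R.
Proof.
have h : (fun h : R => h^-1 *: (((fun x : 'rV[R]_n => x 0 j) \o shift y) (h *: evec R i)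
    - y 0 j)) @ 0^' --> ((i == j)%:R : R).
  apply: cvg_near_cst; near=> h => /=.
  rewrite /evec !mxE eqxx addrK /= eq_sym /GRing.scale /= mulrA mulVf ?mul1r//.
  by near: h; exact: nbhs_dnbhs_neq.
by apply: DeriveDef; [apply/cvg_ex; exists (i == j)%:R|apply/cvg_lim].
Unshelve. all: by end_near. Qed.

Lemma Cdir_coord {R : realType} n k (U : set 'rV[R]_n) (j : 'I_n) :
  Cdir (@evec R n) k U (fun x => x 0 j).
Proof.
case: k => [|k]; first by split=> // x _; exact: coord_continuous.
split=> [x _|i]; first exact: coord_continuous.
by exists (fun=> (i == j)%:R) => [x _|]; [exact: is_derive_coord|exact: Cdir_cst].
Qed.

Lemma is_derive_sumsq {R : realType} n m (s : 'I_m -> 'I_n) (i : 'I_n) (y : 'rV[R]_n) :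
  is_derive y (evec R i) (fun x => \sum_(j < m) x 0 (s j) ^+ 2)
    (\sum_(j < m) 2 * y 0 (s j) * (i == s j)%:R).
Proof.
have h j : is_derive y (evec R i) (fun x : 'rV[R]_n => x 0 (s j) ^+ 2)
    (2 * y 0 (s j) * (i == s j)%:R).
  have := is_deriveM_fun (is_derive_coord i (s j) y) (is_derive_coord i (s j) y).
  have -> : (i == s j)%:R * y 0 (s j) + y 0 (s j) * (i == s j)%:R
    = 2 * y 0 (s j) * (i == s j)%:R by ring.
  by [].
have := @is_derive_sum _ _ _ m (fun j (x : 'rV[R]_n) => x 0 (s j) ^+ 2) y (evec R i) _ h.
congr (is_derive _ _ _ _); apply/funext => x.
by rewrite fct_sumE.
Qed.

Definition sqradius {R : realType} (z : 'rV[R]_(1 + 3)) : R :=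
  \sum_(i < 3) z 0 (rshift 1 i) ^+ 2.

Definition cone_ratio {R : realType} (z : 'rV[R]_(1 + 3)) : R :=
  sqradius z * (time z)^-1 ^+ 2.

Definition tdir : 'I_(1 + 3) := lshift 3 ord0.
Definition xdir (i : 'I_3) : 'I_(1 + 3) := rshift 1 i.

(** The first partials are prescribed on the whole open half-space t > 0, so that differentiating
    them at [z] gives genuine second partials. The relational form makes sums and chain rules
    composable. *)
Definition is_box {R : realType} (f : 'rV[R]_(1 + 3) -> R) (z : 'rV[R]_(1 + 3)) (b : R) :=
  exists (g : 'I_(1 + 3) -> 'rV[R]_(1 + 3) -> R) (h : 'I_(1 + 3) -> R),
  [/\ forall i y, 0 < time y -> is_derive y (evec R i) f (g i y),
      forall i, is_derive z (evec R i) (g i) (h i) &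
      b = - h tdir + \sum_(i < 3) h (xdir i)].

Lemma open_time_gt0 {R : realType} d : open [set z : 'rV[R]_(1 + d) | 0 < time z].
Proof.
apply: (@open_comp _ _ (fun z : 'rV[R]_(1 + d) => time z) [set x | 0 < x]).
  by move=> z _; exact: coord_continuous.
exact: open_gt.
Qed.

Lemma is_boxD {R : realType} (f f' : 'rV[R]_(1 + 3) -> R) z b b' :
  is_box f z b -> is_box f' z b' -> is_box (fun y => f y + f' y) z (b + b').
Proof.
move=> [g [h [dg dh ->]]] [g' [h' [dg' dh' ->]]].
exists (fun i y => g i y + g' i y), (fun i => h i + h' i); split.
- by move=> i y y0; apply: is_deriveD_fun; [exact: dg|exact: dg'].
- by move=> i; exact: is_deriveD_fun.
- by rewrite big_split /=; ring.
Qed.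

Lemma is_boxN {R : realType} (f : 'rV[R]_(1 + 3) -> R) z b :
  is_box f z b -> is_box (fun y => - f y) z (- b).
Proof.
move=> [g [h [dg dh ->]]].
exists (fun i y => - g i y), (fun i => - h i); split.
- by move=> i y y0; apply: is_deriveN_fun; exact: dg.
- by move=> i; exact: is_deriveN_fun.
- by rewrite sumrN; ring.
Qed.

Lemma is_box0 {R : realType} (z : 'rV[R]_(1 + 3)) : is_box (fun=> 0) z 0.
Proof.
exists (fun i y => 0), (fun i => 0); split.
- by move=> i y y0; exact: is_derive_cst.
- by move=> i; exact: is_derive_cst.
- by rewrite big1// oppr0 addr0.
Qed.

Lemma is_box_eq {R : realType} (f : 'rV[R]_(1 + 3) -> R) z b b' :
  b = b' -> is_box f z b -> is_box f z b'.
Proof. by move=> ->. Qed.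

(** Partials of a row-valued map are componentwise only where every component is derivable. The
    inner claim [d2] secures this near [z] for the first partials, hence at [z] for the second
    ones. *)
Lemma dalembertian_row {R : realType} m (u : 'rV[R]_(1 + 3) -> 'rV[R]_m) z
    (b : 'I_m -> R) :
  0 < time z -> (forall j, is_box (fun y => u y 0 j) z (b j)) ->
  dalembertian u z = \row_j b j.
Proof.
move=> z0 ub; apply/rowP => j; rewrite mxE.
have d1 i y k : 0 < time y -> derivable (fun x => u x 0 k) y (evec R i).
  by move=> y0; have [g [h [dg _ _]]] := ub k; have [] := dg i y y0.
have nz : \near z, 0 < time z.
  exact: (open_nbhs_nbhs (conj (@open_time_gt0 R 3) z0)).
have d2 i k : exists2 h, is_derive z (evec R i) (fun y => pderiv i u y 0 k) h &
    forall g h', (forall y, 0 < time y -> is_derive y (evec R i) (fun x => u x 0 k) (g y)) ->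
    is_derive z (evec R i) g h' -> h = h'.
  have [g [h [dg dh _]]] := ub k.
  have gE y : 0 < time y -> g i y = pderiv i u y 0 k.
    move=> y0; rewrite /pderiv derive_row => [|l]; last exact: d1.
    by have [_ ->] := dg i y y0.
  exists (h i).
    by apply: near_eq_is_derive (dh i); apply: filterS nz => y; exact: gE.
  move=> g' h' dg' [_ <-]; have [_ <-] := dh i; apply: near_eq_derive.
  apply: filterS nz => y y0.
  by have [_ <-] := dg i y y0; have [_ <-] := dg' y y0.
have E i k : pderiv i (pderiv i u) z 0 k = 'D_(evec R i) (fun y => pderiv i u y 0 k) z.
  by rewrite /pderiv derive_row// => l; have [h [dh _] _] := d2 i l.
have [g [h [dg dh ->]]] := ub j.
have Eh i : pderiv i (pderiv i u) z 0 j = h i.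
  have [h' [_ h'E] uniq] := d2 i j; rewrite E h'E.
  by apply: (uniq (g i) (h i) _ (dh i)) => y y0; exact: dg.
rewrite /dalembertian mxE [in X in X + _]mxE summxE; congr (- _ + _).
  exact: Eh.
by apply: eq_bigr => i _; exact: Eh.
Qed.

(** The chain rule with q = |x|^2 / t^2, whose time derivative is -2 q / t. The coefficient 6 in
    front of H' is 2 times the space dimension in the Laplacian, and equals t^2 / q times the second
    time derivative of q as well. *)
Lemma is_box_PH {R : realType} (P P' H : R -> R) (P'' H' H'' : R -> R) (z : 'rV[R]_(1 + 3)) :
  (forall t : R, 0 < t -> is_derive t 1 P (P' t)) ->
  (forall t : R, 0 < t -> is_derive t 1 P' (P'' t)) ->
  (forall q : R, is_derive q 1 H (H' q)) ->
  (forall q : R, is_derive q 1 H' (H'' q)) ->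
  0 < time z ->
  let q := cone_ratio z in let t := time z in
  is_box (fun y => P (time y) * H (cone_ratio y)) z
    (- P'' t * H q + 4 * q * P' t * H' q / t
     + P t * (4 * q * (1 - q) * H'' q + 6 * (1 - q) * H' q) / t ^+ 2).
Proof.
move=> dP dP' dH dH' z0 q t.
have dtime i (y : 'rV[R]_(1 + 3)) : is_derive y (evec R i) (@time R 3) (i == tdir)%:R.
  exact: is_derive_coord.
have drad i (y : 'rV[R]_(1 + 3)) : is_derive y (evec R i) sqradius
    (\sum_(j < 3) 2 * y 0 (xdir j) * (i == xdir j)%:R).
  exact: is_derive_sumsq.
(* Along direction [i], the first derivatives of |x|^2, t and q are [rho], [tau] and [kappa];
   [sigma] and [dkappa] are the second derivatives of |x|^2 and q. *)
pose rho i (y : 'rV[R]_(1 + 3)) := \sum_(j < 3) 2 * y 0 (xdir j) * (i == xdir j)%:R.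
pose tau i : R := (i == tdir)%:R.
have dinv i (y : 'rV[R]_(1 + 3)) : 0 < time y ->
    is_derive y (evec R i) (fun x => (time x)^-1) (- ((time y)^-1 ^+ 2) * tau i).
  move=> y0; apply: (is_derive_comp_fun (h := fun x : R => x^-1)) (dtime i y).
  exact: is_derive_inv_id (lt0r_neq0 y0).
pose I (y : 'rV[R]_(1 + 3)) := (time y)^-1.
pose kappa i y := rho i y * I y ^+ 2 - 2 * tau i * cone_ratio y * I y.
have dratio i (y : 'rV[R]_(1 + 3)) : 0 < time y -> is_derive y (evec R i) cone_ratio (kappa i y).
  move=> y0.
  apply: is_derive_eq (is_deriveM_fun (drad i y) (is_deriveM_fun (dinv i y y0) (dinv i y y0))) _.
  by rewrite /kappa /rho /cone_ratio /I /=; ring.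
pose sigma i : R := \sum_(j < 3) 2 * (i == xdir j)%:R * (i == xdir j)%:R.
have drho i (y : 'rV[R]_(1 + 3)) : is_derive y (evec R i) (rho i) (sigma i).
  have h (j : 'I_3) : is_derive y (evec R i)
      (fun x : 'rV[R]_(1 + 3) => 2 * x 0 (xdir j) * (i == xdir j)%:R)
      (2 * (i == xdir j)%:R * (i == xdir j)%:R).
    apply: is_derive_eq (is_deriveM_fun (is_deriveM_fun (is_derive_cst (2 : R) _ _)
      (is_derive_coord i (xdir j) y)) (is_derive_cst ((i == xdir j)%:R : R) _ _)) _.
    by rewrite /cst; ring.
  have := @is_derive_sum _ _ _ 3 (fun j (x : 'rV[R]_(1 + 3)) =>
    2 * x 0 (xdir j) * (i == xdir j)%:R) y (evec R i) _ h.
  by congr (is_derive _ _ _ _); apply/funext => x; rewrite fct_sumE.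
pose dkappa i := sigma i * I z ^+ 2 - 2 * rho i z * I z ^+ 3 * tau i
  - 2 * tau i * (kappa i z * I z - cone_ratio z * I z ^+ 2 * tau i).
have dkap i : is_derive z (evec R i) (kappa i) (dkappa i).
  apply: is_derive_eq (is_deriveD_fun
    (is_deriveM_fun (drho i z) (is_deriveM_fun (dinv i z z0) (dinv i z z0)))
    (is_deriveN_fun (is_deriveM_fun (is_deriveM_fun
      (is_derive_cst (2 * tau i) _ _) (dratio i z z0)) (dinv i z z0)))) _.
  by rewrite /dkappa /cst /I; ring.
exists (fun i y => P' (time y) * tau i * H (cone_ratio y) + P (time y) * (H' (cone_ratio y) * kappa i y)),
  (fun i => P'' t * tau i * tau i * H q + 2 * (P' t * tau i) * (H' q * kappa i z)
   + P t * (H'' q * kappa i z * kappa i z + H' q * dkappa i)); split.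
- move=> i y y0.
  exact: is_deriveM_fun (is_derive_comp_fun (dP _ y0) (dtime i y))
    (is_derive_comp_fun (dH _) (dratio i y y0)).
- move=> i.
  apply: is_derive_eq (is_deriveD_fun (is_deriveM_fun (is_deriveM_fun
     (is_derive_comp_fun (dP' _ z0) (dtime i z)) (is_derive_cst (tau i) _ _))
     (is_derive_comp_fun (dH _) (dratio i z z0)))
    (is_deriveM_fun (is_derive_comp_fun (dP _ z0) (dtime i z))
      (is_deriveM_fun (is_derive_comp_fun (dH' _) (dratio i z z0)) (dkap i)))) _.
  by rewrite /cst -/(tau i) -/q -/t; ring.
- have tau_t : tau tdir = 1 by rewrite /tau eqxx.
  have tau_x j : tau (xdir j) = 0 by rewrite /tau /tdir /xdir eq_rlshift.
  have rho_t : rho tdir z = 0.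
    by rewrite /rho big1// => j _; rewrite /tdir /xdir eq_lrshift mulr0.
  have sigma_t : sigma tdir = 0.
    by rewrite /sigma big1// => j _; rewrite /tdir /xdir eq_lrshift mulr0.
  have rho_x j : rho (xdir j) z = 2 * z 0 (xdir j).
    rewrite /rho (bigD1 j)//= big1 ?addr0 => [|k kj]; rewrite /xdir eq_rshift.
      by rewrite eqxx mulr1.
    by rewrite eq_sym (negbTE kj) mulr0.
  have sigma_x j : sigma (xdir j) = 2.
    rewrite /sigma (bigD1 j)//= big1 ?addr0 => [|k kj]; rewrite /xdir eq_rshift.
      by rewrite eqxx !mulr1.
    by rewrite eq_sym (negbTE kj) mulr0.
  have t0 : t != 0 by rewrite gt_eqF.
  have qE : (z 0 (xdir 0)) ^+ 2 + (z 0 (xdir 1)) ^+ 2 + (z 0 (xdir 2)) ^+ 2 = q * t ^+ 2.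
    rewrite /q /cone_ratio /sqradius !big_ord_recr big_ord0 /= add0r -/t exprVn divfK ?expf_neq0//.
    by congr (_ ^+ 2 + _ ^+ 2 + _ ^+ 2); congr (z _ _); apply: val_inj.
  pose i0 : 'I_3 := 0; pose i1 : 'I_3 := 1; pose i2 : 'I_3 := 2.
  have sum3 (f : 'I_3 -> R) : \sum_(j < 3) f j = f i0 + f i1 + f i2.
    rewrite !big_ord_recr big_ord0 /= add0r.
    by congr (f _ + f _ + f _); apply: val_inj.
  rewrite sum3 /dkappa /kappa -/q !tau_x !rho_x !sigma_x tau_t rho_t sigma_t /I -/t.
  have {}qE : z 0 (xdir i0) ^+ 2 = q * t ^+ 2 - z 0 (xdir i1) ^+ 2 - z 0 (xdir i2) ^+ 2.
    by rewrite -qE /i0 /i1 /i2; ring.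
  move: (z 0 (xdir i0)) (z 0 (xdir i1)) (z 0 (xdir i2)) qE => x0 x1 x2 qE.
  move: (P t) (P' t) (P'' t) (H q) (H' q) (H'' q) => p p1 p2 h0 h1 h2.
  (* The first bracket is the second time derivative, the rest the Laplacian; |x|^2 = q t^2 is used
     only in the latter. *)
  transitivity (- (p2 * h0 + 2 * p1 * (h1 * (- 2 * q * t^-1)) +
      p * (h2 * (4 * q ^+ 2 * t^-1 ^+ 2) + h1 * (6 * q * t^-1 ^+ 2)))
    + (p * (h2 * 4 * t^-1 ^+ 4 * (x0 ^+ 2 + x1 ^+ 2 + x2 ^+ 2) + h1 * 6 * t^-1 ^+ 2))).
    by rewrite qE; field.
  by ring.
Qed.

(** This is t^(-a) for t > 0. Together with the next two functions it gives the real and imaginary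
    parts of t^(-a + i w). *)
Definition decay {R : realType} (a t : R) : R := expR (- a * ln t).

Definition decay_cos {R : realType} (a w t : R) : R := decay a t * cos (w * ln t).

Definition decay_sin {R : realType} (a w t : R) : R := decay a t * sin (w * ln t).

Lemma is_derive_decay {R : realType} (a t : R) : 0 < t ->
  is_derive t 1 (decay a) (- a * decay a t * t^-1).
Proof.
move=> t0.
have dl : is_derive t 1 (fun x => - a * ln x) (- a * t^-1).
  apply: is_derive_eq (is_deriveM_fun (is_derive_cst (- a) t 1) (is_derive1_ln t0)) _.
  by rewrite mul0r add0r.
apply: is_derive_eq (@is_derive_comp_fun _ _ (@expR R) (fun x : R => - a * ln x) t 1 _ _
  (is_derive_expR _) dl) _.
by rewrite /decay; ring.
Qed.

Lemma is_derive_decay_cos {R : realType} (a w t : R) : 0 < t ->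
  is_derive t 1 (decay_cos a w) ((- a * decay_cos a w t - w * decay_sin a w t) * t^-1).
Proof.
move=> t0.
have dl : is_derive t 1 (fun x => w * ln x) (w * t^-1).
  apply: is_derive_eq (is_deriveM_fun (is_derive_cst w t 1) (is_derive1_ln t0)) _.
  by rewrite mul0r add0r.
apply: is_derive_eq (is_deriveM_fun (is_derive_decay a t0)
  (@is_derive_comp_fun _ _ (@cos R) (fun x : R => w * ln x) t 1 _ _ (is_derive_cos _) dl)) _.
by rewrite /decay_cos /decay_sin; ring.
Qed.

Lemma is_derive_decay_sin {R : realType} (a w t : R) : 0 < t ->
  is_derive t 1 (decay_sin a w) ((- a * decay_sin a w t + w * decay_cos a w t) * t^-1).
Proof.
move=> t0.
have dl : is_derive t 1 (fun x => w * ln x) (w * t^-1).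
  apply: is_derive_eq (is_deriveM_fun (is_derive_cst w t 1) (is_derive1_ln t0)) _.
  by rewrite mul0r add0r.
apply: is_derive_eq (is_deriveM_fun (is_derive_decay a t0)
  (@is_derive_comp_fun _ _ (@sin R) (fun x : R => w * ln x) t 1 _ _ (is_derive_sin _) dl)) _.
by rewrite /decay_cos /decay_sin; ring.
Qed.

Lemma is_box_decay {R : realType} (a : R) (H : R -> R) z : smooth H -> 0 < time z ->
  is_box (fun y => decay a (time y) * H (cone_ratio y)) z
    (decay a (time z) * profile_box a H (cone_ratio z) / time z ^+ 2).
Proof.
move=> sH z0; have t0 : time z != 0 by rewrite gt_eqF.
apply: is_box_eq (@is_box_PH _ (decay a) (fun t => - a * decay a t * t^-1) H
  (fun t => a * (a + 1) * decay a t * t^-1 ^+ 2) ('D_1 H) ('D_1 ('D_1 H)) z _ _ _ _ z0).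
- by rewrite /profile_box; field.
- exact: is_derive_decay.
- move=> t t_gt0.
  apply: is_derive_eq (is_deriveM_fun (is_deriveM_fun (is_derive_cst (- a) t 1)
    (is_derive_decay a t_gt0)) (is_derive_inv_id (lt0r_neq0 t_gt0))) _.
  by rewrite /cst; ring.
- by move=> q; exact: smooth_is_derive.
- by move=> q; apply: smooth_is_derive; exact: smooth_derive.
Qed.

(** The coefficients of the second time derivative come from (-a + i w)(-a - 1 + i w) = a (a + 1) -
    w^2 - i w (2 a + 1); its imaginary part mixes cosine and sine. *)
Lemma is_box_decay_cos {R : realType} (a w : R) (H : R -> R) z : smooth H -> 0 < time z ->
  is_box (fun y => decay_cos a w (time y) * H (cone_ratio y)) z
    ((decay_cos a w (time z) * (profile_box a H (cone_ratio z) + w ^+ 2 * H (cone_ratio z))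
     - w * decay_sin a w (time z) * (4 * cone_ratio z * 'D_1 H (cone_ratio z) + (2 * a + 1) * H (cone_ratio z)))
      / time z ^+ 2).
Proof.
move=> sH z0; have t0 : time z != 0 by rewrite gt_eqF.
apply: is_box_eq (@is_box_PH _ (decay_cos a w)
  (fun t => (- a * decay_cos a w t - w * decay_sin a w t) * t^-1) H
  (fun t => ((a * (a + 1) - w ^+ 2) * decay_cos a w t
     + w * (2 * a + 1) * decay_sin a w t) * t^-1 ^+ 2) ('D_1 H) ('D_1 ('D_1 H)) z _ _ _ _ z0).
- by rewrite /profile_box; field.
- exact: is_derive_decay_cos.
- move=> t t_gt0.
  apply: is_derive_eq (is_deriveM_fun (is_deriveD_fun
    (is_deriveM_fun (is_derive_cst (- a) t 1) (is_derive_decay_cos a w t_gt0))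
    (is_deriveN_fun (is_deriveM_fun (is_derive_cst w t 1) (is_derive_decay_sin a w t_gt0))))
    (is_derive_inv_id (lt0r_neq0 t_gt0))) _.
  by rewrite /cst; ring.
- by move=> q; exact: smooth_is_derive.
- by move=> q; apply: smooth_is_derive; exact: smooth_derive.
Qed.

Lemma is_box_decay_sin {R : realType} (a w : R) (H : R -> R) z : smooth H -> 0 < time z ->
  is_box (fun y => decay_sin a w (time y) * H (cone_ratio y)) z
    ((decay_sin a w (time z) * (profile_box a H (cone_ratio z) + w ^+ 2 * H (cone_ratio z))
     + w * decay_cos a w (time z) * (4 * cone_ratio z * 'D_1 H (cone_ratio z) + (2 * a + 1) * H (cone_ratio z)))
      / time z ^+ 2).
Proof.
move=> sH z0; have t0 : time z != 0 by rewrite gt_eqF.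
apply: is_box_eq (@is_box_PH _ (decay_sin a w)
  (fun t => (- a * decay_sin a w t + w * decay_cos a w t) * t^-1) H
  (fun t => ((a * (a + 1) - w ^+ 2) * decay_sin a w t
     - w * (2 * a + 1) * decay_cos a w t) * t^-1 ^+ 2) ('D_1 H) ('D_1 ('D_1 H)) z _ _ _ _ z0).
- by rewrite /profile_box; field.
- exact: is_derive_decay_sin.
- move=> t t_gt0.
  apply: is_derive_eq (is_deriveM_fun (is_deriveD_fun
    (is_deriveM_fun (is_derive_cst (- a) t 1) (is_derive_decay_sin a w t_gt0))
    (is_deriveM_fun (is_derive_cst w t 1) (is_derive_decay_cos a w t_gt0)))
    (is_derive_inv_id (lt0r_neq0 t_gt0))) _.
  by rewrite /cst; ring.
- by move=> q; exact: smooth_is_derive.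
- by move=> q; apply: smooth_is_derive; exact: smooth_derive.
Qed.

Lemma Cdir_time {R : realType} k :
  Cdir (@evec R (1 + 3)) k [set z | 0 < time z] (@time R 3).
Proof. exact: Cdir_coord. Qed.

Lemma Cdir_cone_ratio {R : realType} k :
  Cdir (@evec R (1 + 3)) k [set z | 0 < time z] cone_ratio.
Proof.
apply: CdirM; first by apply: Cdir_sum => i; apply: CdirX; exact: Cdir_coord.
apply: CdirX; apply: (@Cdir_comp _ _ _ _ k [set x : R | x != 0] _ (fun x : R => x^-1) (@time R 3)).
- exact: Cline_inv.
- exact: Cdir_time.
- by move=> z /= z0; rewrite gt_eqF.
Qed.

Lemma Cdir_log {R : realType} k (c : R) :
  Cdir (@evec R (1 + 3)) k [set z | 0 < time z] (fun z => c * ln (time z)).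
Proof.
apply: CdirM; first exact: Cdir_cst.
exact: (Cdir_comp (Cline_ln (R := R) k) (Cdir_time k)).
Qed.

Lemma Cdir_decay {R : realType} k (a : R) :
  Cdir (@evec R (1 + 3)) k [set z | 0 < time z] (fun z => decay a (time z)).
Proof.
exact: (Cdir_comp (Cline_expR k setT) (Cdir_log k (- a))).
Qed.

Lemma Cdir_decay_cos {R : realType} k (a w : R) :
  Cdir (@evec R (1 + 3)) k [set z | 0 < time z] (fun z => decay_cos a w (time z)).
Proof.
apply: CdirM; first exact: Cdir_decay.
exact: (Cdir_comp (Cline_sincos k setT).2 (Cdir_log k w)).
Qed.

Lemma Cdir_decay_sin {R : realType} k (a w : R) :
  Cdir (@evec R (1 + 3)) k [set z | 0 < time z] (fun z => decay_sin a w (time z)).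
Proof.
apply: CdirM; first exact: Cdir_decay.
exact: (Cdir_comp (Cline_sincos k setT).1 (Cdir_log k w)).
Qed.

Lemma Cdir_profile {R : realType} k (H : R -> R) : smooth H ->
  Cdir (@evec R (1 + 3)) k [set z | 0 < time z] (fun z => H (cone_ratio z)).
Proof. by move=> sH; exact: (Cdir_comp (sH k) (Cdir_cone_ratio k)). Qed.

(** * The potential *)

Definition normsq {R : realType} n (v : 'rV[R]_n) : R := \sum_(j < n) v 0 j ^+ 2.

(** The coordinates of v / |v|, with 1 / |v| expressed through the smooth function ln |v|^2. *)
Definition unitc {R : realType} n (k : 'I_n) (v : 'rV[R]_n) : R :=
  v 0 k * expR (- (1 / 2) * ln (normsq v)).

Lemma normsq_ge0 {R : realType} n (v : 'rV[R]_n) : 0 <= normsq v.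
Proof. by apply: sumr_ge0 => j _; exact: sqr_ge0. Qed.

Lemma normsq_gt0 {R : realType} n (v : 'rV[R]_n) : (0 < normsq v) = (v != 0).
Proof.
rewrite lt_neqAle normsq_ge0 andbT eq_sym; congr negb; apply/eqP/eqP => [|->].
  move=> /psumr_eq0P h; apply/rowP => j; rewrite mxE.
  by apply/eqP; rewrite -sqrf_eq0; apply/eqP; apply: h => // k _; exact: sqr_ge0.
by rewrite /normsq big1// => j _; rewrite mxE expr0n.
Qed.

Lemma normsqZ {R : realType} n (l : R) (v : 'rV[R]_n) :
  normsq (l *: v) = l ^+ 2 * normsq v.
Proof. by rewrite /normsq mulr_sumr; apply: eq_bigr => j _; rewrite mxE exprMn. Qed.

Lemma is_derive_normsq {R : realType} n (i : 'I_n) (v : 'rV[R]_n) :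
  is_derive v (evec R i) (@normsq R n) (2 * v 0 i).
Proof.
have := is_derive_sumsq id i v; rewrite (bigD1 i)//= big1 ?addr0 ?eqxx ?mulr1//.
by move=> j ji; rewrite eq_sym (negbTE ji) mulr0.
Qed.

Lemma Cdir_normsq {R : realType} n k (U : set 'rV[R]_n) :
  Cdir (@evec R n) k U (@normsq R n).
Proof. by apply: Cdir_sum => i; apply: CdirX; exact: Cdir_coord. Qed.

Lemma open_neq0_row {R : realType} n : open [set v : 'rV[R]_n | v != 0].
Proof.
have -> : [set v : 'rV[R]_n | v != 0] = @normsq R n @^-1` [set x | 0 < x].
  by apply/seteqP; split=> v /=; rewrite normsq_gt0.
apply: open_comp; last exact: open_gt.
by move=> v _; exact: (Cdir_cont (Cdir_normsq 0 setT)).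
Qed.

Lemma Cdir_ln_normsq {R : realType} n k :
  Cdir (@evec R n) k [set v | v != 0] (fun v => ln (normsq v)).
Proof.
apply: (Cdir_comp (Cline_ln (R := R) k) (Cdir_normsq k [set v | v != 0])) => v /=.
by rewrite normsq_gt0.
Qed.

Lemma Cdir_unitc {R : realType} n k (j : 'I_n) :
  Cdir (@evec R n) k [set v | v != 0] (unitc j).
Proof.
apply: CdirM; first exact: Cdir_coord.
apply: (Cdir_comp (Cline_expR k setT)) => //.
by apply: CdirM; [exact: Cdir_cst|exact: Cdir_ln_normsq].
Qed.

Lemma is_derive_ln_normsq {R : realType} n (i : 'I_n) (v : 'rV[R]_n) : v != 0 ->
  is_derive v (evec R i) (fun x => ln (normsq x)) ((normsq v)^-1 * (2 * v 0 i)).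
Proof.
rewrite -normsq_gt0 => v0.
exact: is_derive_comp_fun (is_derive1_ln v0) (is_derive_normsq i v).
Qed.

Lemma is_derive_unitc {R : realType} n (i j : 'I_n) (v : 'rV[R]_n) : v != 0 ->
  is_derive v (evec R i) (unitc j)
    (expR (- (1 / 2) * ln (normsq v)) * ((i == j)%:R - v 0 j * v 0 i * (normsq v)^-1)).
Proof.
move=> v0.
have dl : is_derive v (evec R i) (fun x => - (1 / 2) * ln (normsq x))
    (- ((normsq v)^-1 * v 0 i)).
  apply: is_derive_eq (is_deriveM_fun (is_derive_cst (- (1 / 2) : R) _ _)
    (is_derive_ln_normsq i v0)) _.
  by rewrite /cst; field; rewrite gt_eqF// normsq_gt0.
apply: is_derive_eq (is_deriveM_fun (is_derive_coord i j v)
  (@is_derive_comp_fun _ _ (@expR R) (fun x : 'rV[R]_n => - (1 / 2) * ln (normsq x)) v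
   (evec R i) _ _ (is_derive_expR _) dl)) _.
by ring.
Qed.

Lemma unitcZ {R : realType} n (j : 'I_n) (l : R) (v : 'rV[R]_n) : 0 < l -> v != 0 ->
  unitc j (l *: v) = unitc j v.
Proof.
move=> l0; rewrite -normsq_gt0 => v0.
rewrite /unitc normsqZ mxE lnM ?posrE ?exprn_gt0// lnXn// mulrDr expRD.
have -> : - (1 / 2) * (ln l *+ 2) = - ln l by rewrite mulr2n; field.
by rewrite expRN lnK ?posrE//; field; rewrite gt_eqF.
Qed.

(* At a point of the self-similar field, [nu 0 / e] is [|x|^2 / t^2] and the
   pair [(nu 3, nu 4)] is the rotating one. *)
Definition angular {R : realType} n (e : R) (w L1 L2 Lg : R -> R) (v : 'rV[R]_n.+4.+1) : R :=
  let nu k := unitc (inord k : 'I_n.+4.+1) v in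
  w (nu 0 * e^-1) + L1 (nu 0 * e^-1) * nu 1 + L2 (nu 0 * e^-1) * nu 2
  + Lg (nu 0 * e^-1) * (nu 3 ^+ 2 + nu 4 ^+ 2).

Definition pot {R : realType} n (p e : R) (w L1 L2 Lg : R -> R) (v : 'rV[R]_n.+4.+1) : R :=
  normsq v `^ ((p + 1) / 2) * expR (angular e w L1 L2 Lg v).

Lemma potE {R : realType} n (p e : R) (w L1 L2 Lg : R -> R) (v : 'rV[R]_n.+4.+1) :
  v != 0 -> pot p e w L1 L2 Lg v =
    expR ((p + 1) / 2 * ln (normsq v) + angular e w L1 L2 Lg v).
Proof.
by rewrite -normsq_gt0 => v0; rewrite /pot /powR (gt_eqF v0) -expRD.
Qed.

Lemma Cdir_angular {R : realType} n k (e : R) (w L1 L2 Lg : R -> R) :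
  smooth w -> smooth L1 -> smooth L2 -> smooth Lg ->
  Cdir (@evec R n.+4.+1) k [set v | v != 0] (angular e w L1 L2 Lg).
Proof.
move=> sw s1 s2 sg.
have cn j : Cdir (@evec R n.+4.+1) k [set v | v != 0] (unitc (inord j : 'I_n.+4.+1)).
  exact: Cdir_unitc.
have cq h : smooth h -> Cdir (@evec R n.+4.+1) k [set v | v != 0]
    (fun v => h (unitc (inord 0 : 'I_n.+4.+1) v * e^-1)).
  move=> sh; apply: (Cdir_comp (sh k)) => //.
  by apply: CdirM => //; exact: Cdir_cst.
rewrite /angular; apply: CdirD; first apply: CdirD; first apply: CdirD.
- exact: cq.
- by apply: CdirM => //; exact: cq.
- by apply: CdirM => //; exact: cq.
- by apply: CdirM; [exact: cq|apply: CdirD; exact: CdirX].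
Qed.

Lemma potential_pot {R : realType} n (p e : R) (w L1 L2 Lg : R -> R) :
  smooth w -> smooth L1 -> smooth L2 -> smooth Lg ->
  potential (pot (n := n) p e w L1 L2 Lg).
Proof.
move=> sw s1 s2 sg k; apply: Cdir_Ck; first exact: open_neq0_row.
apply: (@Cdir_eq _ _ _ _ _ _ (fun v => expR ((p + 1) / 2 * ln (normsq v)
    + angular e w L1 L2 Lg v))).
- exact: open_neq0_row.
- by move=> v v0; rewrite potE.
- apply: (Cdir_comp (Cline_expR k setT)) => //.
  apply: CdirD; last exact: Cdir_angular.
  by apply: CdirM; [exact: Cdir_cst|exact: Cdir_ln_normsq].
Qed.

Lemma defocusing_pot {R : realType} n (p e : R) (w L1 L2 Lg : R -> R) :
  defocusing (pot (n := n) p e w L1 L2 Lg).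
Proof. by move=> v v0; rewrite potE// expR_gt0. Qed.

Lemma homogeneous_pot {R : realType} n (p e : R) (w L1 L2 Lg : R -> R) :
  p + 1 != 0 -> homogeneous (p + 1) (pot (n := n) p e w L1 L2 Lg).
Proof.
(* At the origin both sides vanish, as 0 raised to a nonzero power is 0. *)
move=> p1 l v l0; have [->|v0] := eqVneq v 0.
  have p2 : (p + 1) / 2 != 0 by rewrite mulf_neq0// invr_neq0.
  have N0 : normsq (0 : 'rV[R]_n.+4.+1) = 0.
    by rewrite /normsq big1// => j _; rewrite mxE expr0n.
  by rewrite scaler0 /pot N0 powR0// mul0r mulr0.
have lv0 : l *: v != 0 by rewrite scaler_eq0 negb_or gt_eqF.
have l2 : 0 < l ^+ 2 by exact: exprn_gt0.
rewrite !potE// /angular !unitcZ// normsqZ lnM ?posrE ?normsq_gt0// lnXn//.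
rewrite mulrDr -addrA expRD; congr (_ * _).
by rewrite /powR (gt_eqF l0); congr expR; rewrite mulr2n; field.
Qed.

(** Here P is |v| and (e q, U1, ..., U4) are the first coordinates of v / |v|. Differentiating a
    coordinate of v / |v| projects onto the tangent space of the sphere, which produces the factors
    d k - U_k v_i / P. *)
Lemma is_derive_angular {R : realType} n (e : R) (w L1 L2 Lg : R -> R) (i : 'I_n.+4.+1)
    (v : 'rV[R]_n.+4.+1) (P q U1 U2 U3 U4 : R) :
  smooth w -> smooth L1 -> smooth L2 -> smooth Lg -> e != 0 -> v != 0 ->
  expR (- (1 / 2) * ln (normsq v)) = P^-1 -> (normsq v)^-1 = P^-1 ^+ 2 ->
  v 0 (inord 0) = P * (e * q) -> v 0 (inord 1) = P * U1 -> v 0 (inord 2) = P * U2 ->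
  v 0 (inord 3) = P * U3 -> v 0 (inord 4) = P * U4 -> P != 0 ->
  let d k := (i == inord k :> 'I_n.+4.+1)%:R in
  is_derive v (evec R i) (angular e w L1 L2 Lg)
    (P^-1 * (('D_1 w q + 'D_1 L1 q * U1 + 'D_1 L2 q * U2 + 'D_1 Lg q * (U3 ^+ 2 + U4 ^+ 2)) / e
              * (d 0%N - e * q * (v 0 i / P))
            + L1 q * (d 1%N - U1 * (v 0 i / P)) + L2 q * (d 2%N - U2 * (v 0 i / P))
            + 2 * Lg q * (U3 * (d 3%N - U3 * (v 0 i / P)) + U4 * (d 4%N - U4 * (v 0 i / P))))).
Proof.
move=> sw s1 s2 sg e0 v0 hr hN v_0 v_1 v_2 v_3 v_4 P0 d.
pose nu (k : nat) : 'rV[R]_n.+4.+1 -> R := unitc (inord k).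
have dnu k : is_derive v (evec R i) (nu k)
    (P^-1 * (d k - v 0 (inord k) * v 0 i * P^-1 ^+ 2)).
  by rewrite -hN -hr; exact: is_derive_unitc.
have nuE k : nu k v = v 0 (inord k) * P^-1 by rewrite /nu /unitc hr.
have qE : nu 0%N v * e^-1 = q by rewrite nuE v_0; field; rewrite P0 e0.
have dq : is_derive v (evec R i) (fun x => nu 0%N x * e^-1)
    (P^-1 * (d 0%N - v 0 (inord 0) * v 0 i * P^-1 ^+ 2) * e^-1).
  apply: is_derive_eq (is_deriveM_fun (dnu 0%N) (is_derive_cst (e^-1 : R) _ _)) _.
  by rewrite mulr0 addr0.
have dh (h : R -> R) : smooth h -> is_derive v (evec R i) (fun x => h (nu 0%N x * e^-1))
    ('D_1 h q * (P^-1 * (d 0%N - v 0 (inord 0) * v 0 i * P^-1 ^+ 2) * e^-1)).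
  move=> sh; apply: (is_derive_comp_fun _ dq); rewrite qE; exact: smooth_is_derive.
apply: is_derive_eq (is_deriveD_fun (is_deriveD_fun (is_deriveD_fun (dh w sw)
  (is_deriveM_fun (dh L1 s1) (dnu 1%N))) (is_deriveM_fun (dh L2 s2) (dnu 2)))
  (is_deriveM_fun (dh Lg sg) (is_deriveD_fun (is_deriveM_fun (dnu 3) (dnu 3))
    (is_deriveM_fun (dnu 4) (dnu 4))))) _.
rewrite qE !nuE v_0 v_1 v_2 v_3 v_4.
move: ('D_1 w q) ('D_1 L1 q) ('D_1 L2 q) ('D_1 Lg q) (L1 q) (L2 q) (Lg q) (v 0 i)
  (d 0%N) (d 1%N) (d 2) (d 3) (d 4) => *.
by field; rewrite P0 e0.
Qed.

(** * The self-similar field *)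

(** Indexing by [nat] serves every ambient dimension: coordinates past the first five are zero. *)
Definition field_comp {R : realType} (a e : R) (W1 W2 A B : R -> R) (k : nat)
    (y : 'rV[R]_(1 + 3)) : R :=
  let t := time y in let q := cone_ratio y in
  match k with
  | 0 => decay a t * (e * q)
  | 1 => decay a t * W1 q
  | 2 => decay a t * W2 q
  | 3 => decay_cos a e^-1 t * A q + - (decay_sin a e^-1 t * B q)
  | 4 => decay_cos a e^-1 t * B q + decay_sin a e^-1 t * A q
  | _ => 0
  end.

Definition wave_field {R : realType} n (a e : R) (W1 W2 A B : R -> R)
    (y : 'rV[R]_(1 + 3)) : 'rV[R]_n :=
  \row_j field_comp a e W1 W2 A B j y.

Lemma Gamma_cone_ratio {R : realType} (z : 'rV[R]_(1 + 3)) :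
  @Gamma R 3 z -> 0 < time z /\ 0 <= cone_ratio z <= 1.
Proof.
move=> [t0 zt]; split=> //.
have r0 : 0 <= sqradius z by apply: sumr_ge0 => i _; exact: sqr_ge0.
have rE : enorm (Defs.space z) = Num.sqrt (sqradius z).
  by rewrite /enorm /sqradius; congr Num.sqrt; apply: eq_bigr => i _; rewrite !mxE.
rewrite /cone_ratio mulr_ge0//= ?sqr_ge0// exprVn ler_pdivrMr ?exprn_gt0// mul1r.
rewrite -(sqr_sqrtr r0) -rE ler_pXn2r// nnegrE ?(ltW t0)//.
exact: sqrtr_ge0.
Qed.

Lemma time_scale {R : realType} (l : R) (z : 'rV[R]_(1 + 3)) :
  time (l *: z) = l * time z.
Proof. by rewrite /time mxE. Qed.

Lemma cone_ratio_scale {R : realType} (l : R) (z : 'rV[R]_(1 + 3)) : l != 0 ->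
  cone_ratio (l *: z) = cone_ratio z.
Proof.
move=> l0; rewrite /cone_ratio time_scale invfM exprMn.
have -> : sqradius (l *: z) = l ^+ 2 * sqradius z.
  by rewrite /sqradius mulr_sumr; apply: eq_bigr => i _; rewrite mxE exprMn.
by rewrite mulrACA -exprMn mulfV// expr1n mul1r.
Qed.

Lemma decay_scale {R : realType} (a S t : R) : 0 < t ->
  decay a (expR S * t) = expR (- a * S) * decay a t.
Proof.
by move=> t0; rewrite /decay lnM ?posrE ?expR_gt0// expRK mulrDr expRD.
Qed.

Lemma wave_field_scale {R : realType} n (a e : R) (W1 W2 A B : R -> R)
    (z : 'rV[R]_(1 + 3)) : 0 < e -> 0 < time z ->
  wave_field n a e W1 W2 A B (expR (e * (pi *+ 2)) *: z)
  = expR (- a * (e * (pi *+ 2))) *: wave_field n a e W1 W2 A B z.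
Proof.
move=> e0 t0; set S := e * (pi *+ 2).
(* Scaling adds S = 2 pi e to ln t, which is exactly one full turn of the rotating pair. *)
have wS : e^-1 * ln (expR S * time z) = e^-1 * ln (time z) + pi *+ 2.
  rewrite lnM ?posrE ?expR_gt0// expRK mulrDr addrC; congr (_ + _).
  by rewrite /S mulrA mulVf ?mul1r// gt_eqF.
apply/rowP => j; rewrite !mxE /field_comp time_scale cone_ratio_scale ?gt_eqF ?expR_gt0//.
rewrite /decay_cos /decay_sin wS cosD2pi sinD2pi decay_scale//.
by case: (j : nat) => [|[|[|[|[|k]]]]]; rewrite ?mulr0//; ring.
Qed.

Lemma Cdir_field_comp {R : realType} k (a e : R) (W1 W2 A B : R -> R) j :
  smooth W1 -> smooth W2 -> smooth A -> smooth B ->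
  Cdir (@evec R (1 + 3)) k [set z | 0 < time z] (field_comp a e W1 W2 A B j).
Proof.
move=> s1 s2 sA sB.
have cH H : smooth H -> Cdir (@evec R (1 + 3)) k [set z | 0 < time z]
    (fun z => H (cone_ratio z)) by exact: Cdir_profile.
have cd := @Cdir_decay R k a; have cc := @Cdir_decay_cos R k a e^-1.
have cs := @Cdir_decay_sin R k a e^-1.
case: j => [|[|[|[|[|j]]]]].
- by apply: CdirM => //; apply: CdirM; [exact: Cdir_cst|exact: Cdir_cone_ratio].
- by apply: CdirM => //; exact: cH.
- by apply: CdirM => //; exact: cH.
- by apply: CdirD; [|apply: CdirN]; apply: CdirM => //; exact: cH.
- by apply: CdirD; apply: CdirM => //; exact: cH.
- exact: Cdir_cst.
Qed.

(** From index 3 on, Box multiplies the component by be(q) / t^2; this covers the rotating pair and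
    the vanishing coordinates alike. *)
Definition field_box {R : realType} (a e : R) (W1 W2 A B be : R -> R) (k : nat)
    (y : 'rV[R]_(1 + 3)) : R :=
  let t := time y in let q := cone_ratio y in
  match k with
  | 0 => decay a t * profile_box a ( *%R e) q / t ^+ 2
  | 1 => decay a t * profile_box a W1 q / t ^+ 2
  | 2 => decay a t * profile_box a W2 q / t ^+ 2
  | S (S (S _)) => be q * field_comp a e W1 W2 A B k y / t ^+ 2
  end.

Lemma is_box_field_comp {R : realType} (a e : R) (W1 W2 A B be : R -> R) k z :
  smooth W1 -> smooth W2 -> smooth A -> smooth B -> 0 < time z ->
  let q := cone_ratio z in
  rot_box a e^-1 A B q = be q * A q ->
  profile_box a B q + e^-1 ^+ 2 * B q + e^-1 * (4 * q * 'D_1 A q + (2 * a + 1) * A q)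
    = be q * B q ->
  is_box (field_comp a e W1 W2 A B k) z (field_box a e W1 W2 A B be k z).
Proof.
move=> s1 s2 sA sB z0 q eA eB.
case: k => [|[|[|[|[|k]]]]].
- apply: is_box_decay => //; apply: smoothM; [exact: smooth_cst|exact: smooth_id].
- exact: is_box_decay.
- exact: is_box_decay.
- apply: is_box_eq (is_boxD (is_box_decay_cos a e^-1 sA z0)
    (is_boxN (is_box_decay_sin a e^-1 sB z0))).
  rewrite /field_box /field_comp -/q.
  transitivity ((decay_cos a e^-1 (time z) * (be q * A q)
    - decay_sin a e^-1 (time z) * (be q * B q)) / time z ^+ 2); last by ring.
  rewrite -eA -eB /rot_box.
  move: ('D_1 A q) ('D_1 B q) (profile_box a A q) (profile_box a B q) => *; ring.
- apply: is_box_eq (is_boxD (is_box_decay_cos a e^-1 sB z0)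
    (is_box_decay_sin a e^-1 sA z0)).
  rewrite /field_box /field_comp -/q.
  transitivity ((decay_cos a e^-1 (time z) * (be q * B q)
    + decay_sin a e^-1 (time z) * (be q * A q)) / time z ^+ 2); last by ring.
  rewrite -eA -eB /rot_box.
  move: ('D_1 A q) ('D_1 B q) (profile_box a A q) (profile_box a B q) => *; ring.
- by apply: is_box_eq (is_box0 z); rewrite /field_box /= mulr0 mul0r.
Qed.

Lemma decay_rot_sqr {R : realType} (a w t : R) :
  decay_cos a w t ^+ 2 + decay_sin a w t ^+ 2 = decay a t ^+ 2.
Proof.
rewrite /decay_cos /decay_sin !exprMn -mulrDr.
by rewrite cos2Dsin2 mulr1.
Qed.

Lemma normsq_wave_field {R : realType} n (a e : R) (W1 W2 A B : R -> R)
    (z : 'rV[R]_(1 + 3)) :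
  let q := cone_ratio z in
  (e * q) ^+ 2 + W1 q ^+ 2 + W2 q ^+ 2 + A q ^+ 2 + B q ^+ 2 = 1 ->
  normsq (wave_field n.+4.+1 a e W1 W2 A B z) = decay a (time z) ^+ 2.
Proof.
move=> q g1; rewrite /normsq.
under eq_bigr do rewrite mxE.
rewrite !big_ord_recl /= big1 ?addr0 => [|i _]; last by rewrite expr0n.
rewrite /field_comp -/q.
transitivity (decay a (time z) ^+ 2 * ((e * q) ^+ 2 + W1 q ^+ 2 + W2 q ^+ 2) +
  (decay_cos a e^-1 (time z) ^+ 2 + decay_sin a e^-1 (time z) ^+ 2)
  * (A q ^+ 2 + B q ^+ 2)); first by ring.
rewrite decay_rot_sqr -mulrDr !addrA g1 mulr1//.
Qed.

(** The q-derivative of the angular part is tuned to give [X0] along coordinate 0, where the point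
    is e q. The radial contributions cancel because the last hypothesis is Euler's relation for
    degree p + 1. *)
Lemma grad_pot {R : realType} n (p e : R) (w L1 L2 Lg : R -> R)
    (v : 'rV[R]_n.+4.+1) (i : 'I_n.+4.+1) (P q U1 U2 U3 U4 X0 X1 X2 be V : R) :
  smooth w -> smooth L1 -> smooth L2 -> smooth Lg -> 0 < e -> 0 < P -> 0 < V ->
  normsq v = P ^+ 2 ->
  v 0 (inord 0) = P * (e * q) -> v 0 (inord 1) = P * U1 -> v 0 (inord 2) = P * U2 ->
  v 0 (inord 3) = P * U3 -> v 0 (inord 4) = P * U4 ->
  L1 q = X1 / V -> L2 q = X2 / V -> Lg q = be / (2 * V) ->
  w q + L1 q * U1 + L2 q * U2 + Lg q * (U3 ^+ 2 + U4 ^+ 2) = ln V ->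
  'D_1 w q + 'D_1 L1 q * U1 + 'D_1 L2 q * U2 + 'D_1 Lg q * (U3 ^+ 2 + U4 ^+ 2)
    = X0 * e / V ->
  X0 * (e * q) + X1 * U1 + X2 * U2 + be * (U3 ^+ 2 + U4 ^+ 2) = (p + 1) * V ->
  let d k := (i == inord k :> 'I_n.+4.+1)%:R in
  pderiv i (pot p e w L1 L2 Lg) v =
    expR (p * ln P) * (X0 * d 0%N + X1 * d 1%N + X2 * d 2 + be * (U3 * d 3 + U4 * d 4)).
Proof.
move=> sw s1 s2 sg e0 P0 V0 N v_0 v_1 v_2 v_3 v_4 L1E L2E LgE wE dwE XE d.
have P0' : P != 0 by rewrite gt_eqF.
have e0' : e != 0 by rewrite gt_eqF.
have V0' : V != 0 by rewrite gt_eqF.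
have v0 : v != 0 by rewrite -normsq_gt0 N exprn_gt0.
have lnN : ln (normsq v) = 2 * ln P by rewrite N lnXn// mulr_natl.
have hr : expR (- (1 / 2) * ln (normsq v)) = P^-1.
  have -> : - (1 / 2) * ln (normsq v) = - ln P by rewrite lnN; field.
  by rewrite expRN lnK// posrE.
have hN : (normsq v)^-1 = P^-1 ^+ 2 by rewrite N exprVn.
have dang := is_derive_angular i sw s1 s2 sg e0' v0 hr hN v_0 v_1 v_2 v_3 v_4 P0'.
have angE : angular e w L1 L2 Lg v = ln V.
  rewrite /angular /unitc hr v_0 v_1 v_2 v_3 v_4 -wE.
  have -> : P * (e * q) * P^-1 * e^-1 = q by field; rewrite P0' e0'.
  by congr (_ + _ + _ + _); field.
have nv : \near v, v != 0 by exact: (open_nbhs_nbhs (conj (@open_neq0_row R _) v0)).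
have dpot := @is_derive_comp_fun _ _ (@expR R) (fun x : 'rV[R]_n.+4.+1 =>
  (p + 1) / 2 * ln (normsq x) + angular e w L1 L2 Lg x) v (evec R i) _ _ (is_derive_expR _)
  (is_deriveD_fun (is_deriveM_fun (is_derive_cst ((p + 1) / 2 : R) v (evec R i))
     (is_derive_ln_normsq i v0)) dang).
rewrite /pderiv (@near_eq_derive _ _ _ _ (fun x : 'rV[R]_n.+4.+1 => expR
  ((p + 1) / 2 * ln (normsq x) + angular e w L1 L2 Lg x))); last first.
  by apply: filterS nv => x; exact: potE.
have [_ ->] := dpot; rewrite angE lnN hN dwE L1E L2E LgE mul0r add0r.
have -> : (p + 1) / 2 * (2 * ln P) + ln V = p * ln P + ln P + ln V by field.
rewrite !expRD !lnK ?posrE// -/(d 0%N) -/(d 1%N) -/(d 2) -/(d 3) -/(d 4).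
rewrite -mulrA -mulrA; congr (_ * _).
move: (d 0%N) (d 1%N) (d 2) (d 3) (d 4) (v 0 i) => d0 d1 d2 d3 d4 x.
(* The surplus is v_i / P times the defect in Euler's relation, hence zero. *)
transitivity (X0 * d0 + X1 * d1 + X2 * d2 + be * (U3 * d3 + U4 * d4)
  + x / P * ((p + 1) * V - (X0 * (e * q) + X1 * U1 + X2 * U2 + be * (U3 ^+ 2 + U4 ^+ 2)))).
  by rewrite /cst; field; rewrite P0' V0' e0'.
by rewrite XE subrr mulr0 addr0.
Qed.

Lemma self_similar_solution (R : realType) (n : nat) (p : R) : 5 < p ->
  exists (F : 'rV[R]_n.+4.+1 -> R) (u : 'rV[R]_(1 + 3) -> 'rV[R]_n.+4.+1),
    [/\ potential F, defocusing F & homogeneous (p + 1) F] /\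
    [/\ smooth_upto (@Gamma R 3) u,
        (forall z, @Gamma R 3 z -> u z != 0),
        (forall z, @Gamma R 3 z -> dalembertian u z = grad F (u z)) &
        exists2 S : R, 0 < S &
          forall z, @Gamma R 3 z ->
            u (expR S *: z) = expR (- (2 / (p - 1)) * S) *: u z].
Proof.
move=> p5; set a := 2 / (p - 1).
have p1 : 0 < p - 1 by lra.
have a0 : 0 < a by rewrite divr_gt0.
have a1 : a < 1 / 2 by rewrite ltr_pdivrMr//; lra.
have ap : a * (p - 1) = 2 by rewrite divfK// gt_eqF.
have pa : 2 / a + 2 = p + 1.
  by rewrite -ap mulrAC divff ?mul1r ?gt_eqF//; lra.
have [e [W1 [W2 [A [B [V [be [e0 [sW1 sW2 sA sB] [sV V0] sbe sol]]]]]]]] :=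
  profile_exists a0 a1.
have V0' q : V q != 0 by rewrite gt_eqF.
(* Since the angular factor equals [V] on the curve, dividing by [V] gives the prescribed gradient
   components; the 2 in [Lg] offsets differentiating the squares. The choice of [w] makes the
   exponent equal to ln V there. *)
pose L1 q := profile_box a W1 q * (V q)^-1.
pose L2 q := profile_box a W2 q * (V q)^-1.
pose Lg q := be q * (2 * V q)^-1.
pose w q := ln (V q) - L1 q * W1 q - L2 q * W2 q - Lg q * (A q ^+ 2 + B q ^+ 2).
have sc (c : R) : smooth (fun=> c) by exact: smooth_cst.
have sL1 : smooth L1 by apply: smoothM; [exact: smooth_profile_box|exact: smooth_inv].
have sL2 : smooth L2 by apply: smoothM; [exact: smooth_profile_box|exact: smooth_inv].
have sLg : smooth Lg.
  apply: smoothM => //; apply: smooth_inv => [q|]; first exact: mulr_gt0.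
  exact: smoothM.
have sAB : smooth (fun q => A q ^+ 2 + B q ^+ 2) by apply: smoothD; exact: smoothX.
have sw : smooth w.
  by apply: smoothB; [apply: smoothB; [apply: smoothB; [exact: smooth_ln|]|]|];
    exact: smoothM.
have D0 (f : R -> R) (q : R) : smooth f -> is_derive q 1 f ('D_1 f q).
  exact: smooth_is_derive.
(* In the product rule for [w] the derivatives of [L1], [L2], [Lg] cancel. The last identity of
   [profile_exists] will identify the remainder with X0 e / V. *)
have dw q : 'D_1 w q + 'D_1 L1 q * W1 q + 'D_1 L2 q * W2 q
    + 'D_1 Lg q * (A q ^+ 2 + B q ^+ 2) = ('D_1 V q - profile_box a W1 q * 'D_1 W1 q
    - profile_box a W2 q * 'D_1 W2 q - be q * (A q * 'D_1 A q + B q * 'D_1 B q)) / V q.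
  have [_ ->] := is_deriveD_fun (is_deriveD_fun (is_deriveD_fun
    (is_derive_comp_fun (is_derive1_ln (V0 q)) (D0 _ q sV))
    (is_deriveN_fun (is_deriveM_fun (D0 _ q sL1) (D0 _ q sW1))))
    (is_deriveN_fun (is_deriveM_fun (D0 _ q sL2) (D0 _ q sW2))))
    (is_deriveN_fun (is_deriveM_fun (D0 _ q sLg) (is_deriveD_fun
      (is_derive_sqr_fun (D0 _ q sA)) (is_derive_sqr_fun (D0 _ q sB))))).
  rewrite {2}/L1 {2}/L2 {2}/Lg.
  move: ('D_1 V q) ('D_1 L1 q) ('D_1 L2 q) ('D_1 Lg q) ('D_1 W1 q) ('D_1 W2 q) ('D_1 A q)
    ('D_1 B q) (profile_box a W1 q) (profile_box a W2 q) (V0' q) => *.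
  by field.
pose F : 'rV[R]_n.+4.+1 -> R := pot p e w L1 L2 Lg.
pose u : 'rV[R]_(1 + 3) -> 'rV[R]_n.+4.+1 := wave_field n.+4.+1 a e W1 W2 A B.
have norm_u z : @Gamma R 3 z -> normsq (u z) = decay a (time z) ^+ 2.
  move=> /Gamma_cone_ratio[t0 q01]; apply: normsq_wave_field.
  by have [] := sol _ q01.
exists F, u; split.
  split; [exact: potential_pot|exact: defocusing_pot|apply: homogeneous_pot].
  by rewrite gt_eqF//; lra.
split.
(* The profiles are smooth on all of R, so the field is smooth on the whole half-space t > 0, a
   neighbourhood of the cone including its boundary. *)
- exists [set z | 0 < time z]; split; first exact: open_time_gt0.
    by move=> z [].
  move=> k; apply: Cdir_Ck_row; first exact: open_time_gt0.
  move=> j; have := @Cdir_field_comp R k a e W1 W2 A B j sW1 sW2 sA sB.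
  by congr (Cdir _ _ _ _); apply/funext => z; rewrite mxE.
- move=> z zG; rewrite -normsq_gt0 norm_u// exprn_gt0// expR_gt0//.
- move=> z zG; have [t0 q01] := Gamma_cone_ratio zG.
  set t := time z in t0; set q := cone_ratio z in q01.
  have [g1 [eA eB] e2 e3] := sol q q01.
  have ub (j : 'I_n.+4.+1) : is_box (fun y => u y 0 j) z (field_box a e W1 W2 A B be j z).
    have := is_box_field_comp j sW1 sW2 sA sB t0 eA eB.
    by congr is_box; apply/funext => y; rewrite mxE.
  rewrite (dalembertian_row t0 ub); apply/rowP => i; rewrite !mxE.
  have uE (k : nat) : (k < 5)%N -> u z 0 (inord k) = field_comp a e W1 W2 A B k z.
    by move=> k5; rewrite mxE inordK// (leq_trans k5).
  set P := decay a t.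
  have P0 : 0 < P by exact: expR_gt0.
  have P0' : P != 0 by rewrite gt_eqF.
  have t0' : t != 0 by rewrite gt_eqF.
  pose c := cos (e^-1 * ln t); pose s := sin (e^-1 * ln t).
  have u0 : u z 0 (inord 0) = P * (e * q) by rewrite uE.
  have u1 : u z 0 (inord 1) = P * W1 q by rewrite uE.
  have u2 : u z 0 (inord 2) = P * W2 q by rewrite uE.
  have u3 : u z 0 (inord 3) = P * (c * A q - s * B q).
    by rewrite uE// /field_comp /decay_cos /decay_sin -/t -/q -/P -/c -/s; ring.
  have u4 : u z 0 (inord 4) = P * (c * B q + s * A q).
    by rewrite uE// /field_comp /decay_cos /decay_sin -/t -/q -/P -/c -/s; ring.
  (* The potential sees the rotating pair only through this invariant, so the phase drops out. *)
  have rot : (c * A q - s * B q) ^+ 2 + (c * B q + s * A q) ^+ 2 = A q ^+ 2 + B q ^+ 2.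
    transitivity ((c ^+ 2 + s ^+ 2) * (A q ^+ 2 + B q ^+ 2)); first by ring.
    by rewrite /c /s cos2Dsin2 mul1r.
  (* The relation a (p - 1) = 2 makes P^p = t^(-a - 2), the decay rate of Box u. *)
  have expP : expR (p * ln P) = P / t ^+ 2.
    have lnP : ln P = - a * ln t by rewrite /P /decay expRK.
    have -> : p * ln P = - a * ln t + - (2 * ln t).
      by rewrite lnP -ap; ring.
    by rewrite expRD expRN expRM_natl lnK ?posrE.
  rewrite (grad_pot i sw sL1 sL2 sLg e0 P0 (V0 q) (norm_u z zG) u0 u1 u2 u3 u4
    (erefl _) (erefl _) (erefl _) (X0 := profile_box a ( *%R e) q)).
  + have dE (k : nat) : (k < 5)%N ->
        (i == inord k :> 'I_n.+4.+1) = ((i : nat) == k).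
      by move=> k5; rewrite -val_eqE /= inordK// (leq_trans k5).
    rewrite expP !dE// /field_box /field_comp -/t -/q -/P.
    rewrite /decay_cos /decay_sin -/P -/c -/s.
    move: (profile_box a ( *%R e) q) (profile_box a W1 q) (profile_box a W2 q) => X0 X1 X2.
    by case: (i : nat) => [|[|[|[|[|k]]]]] /=; field.
  + by rewrite rot /w; ring.
  + by rewrite rot dw -e3; congr (_ / _); ring.
  + by rewrite rot e2 pa.
- exists (e * (pi *+ 2)); first by rewrite mulr_gt0// mulr2n addr_gt0// pi_gt0.
  by move=> z [t0 _]; exact: wave_field_scale.
Qed.

Theorem theorem2p1 (R : realType) (d m : nat) (p : R)
    (hd : d = 3%N)
    (hp : 1 + 4 / (d%:R - 2) < p)
    (hm : (2 * maxn ((d + 1) * (d + 6) %/ 2) ((d + 1) * (d + 4) %/ 2 + 5) + 2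
             <= m)%N) :
  exists (F : 'rV[R]_m -> R) (u : 'rV[R]_(1 + d) -> 'rV[R]_m),
    [/\ potential F, defocusing F & homogeneous (p + 1) F] /\
    [/\ smooth_upto (@Gamma R d) u,
        (forall z, @Gamma R d z -> u z != 0),
        (forall z, @Gamma R d z -> dalembertian u z = grad F (u z)) &
        exists2 S : R, 0 < S &
          forall z, @Gamma R d z ->
            u (expR S *: z) = expR (- (2 / (p - 1)) * S) *: u z].
Proof.
subst d; have p5 : 5 < p.
  have e3 : 3%:R - 2 = 1 :> R by ring.
  (* For d = 3 the bound on p is 1 + 4 = 5. *)
  by move: hp; rewrite e3; lra.
(* At d = 3 the bound on m is 40, which leaves room for the five coordinates of the curve. *)
have m5 : (5 <= m)%N by apply: leq_trans hm.
case: m m5 {hm} => [//|[//|[//|[//|[//|n]]]]] _.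
exact: self_similar_solution.
Qed.
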